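(* Let $\mathcal{C}$ be a nowhere dense class of graphs, let $d$ be a positive integer, and let $\varepsilon$ be a positive real. Then there is an integer $k_0$ such that for every graph $G$ in $\mathcal{C}$ and all vertex subsets $A, B\subseteq V(G)$ satisfying $|A \cup B|\geq k_0$, there exist a vertex subset $S\subseteq V(G)$ and disjoint sets $A'\subseteq A$ and $B'\subseteq B$ such that $$|A'|\geq (1-\varepsilon)\cdot |A|,\qquad |B'|\geq \frac{|B|}{|A \cup B|^\varepsilon},\qquad |S|\leq |A \cup B|^\varepsilon,$$ and $S$ $d$-separates $A'$ and $B'$ in $G$.
   Context: All graphs are finite, simple and undirected. The radius of a connected graph $H$ is the least integer $r$ for which some vertex of $H$ is at distance at most $r$ from every vertex of $H$. For a partition $\mathcal{X}$ of $V(G)$ into nonempty parts inducing connected subgraphs, $G/\mathcal{X}$ is the graph with vertex set $\mathcal{X}$ in which two distinct parts $X,Y$ are adjacent if $G$ has an edge with one endpoint in $X$ and the other in $Y$. A graph $H$ is a depth-$r$ minor of $G$ if $H$ is isomorphic to a subgraph of $G/\mathcal{X}$ for some partition $\mathcal{X}$ of $V(G)$ into nonempty parts inducing connected subgraphs of radius at most $r$. A class of graphs $\mathcal{C}$ is nowhere dense if for each integer $r\geq 0$ there exists a graph which is not a depth-$r$ minor of any graph from $\mathcal{C}$. A vertex subset $S$ $d$-separates vertex subsets $A$ and $B$ in a graph $G$ if every path in $G$ of length (number of edges) at most $d$ with one endpoint in $A$ and the other in $B$ intersects $S$ (single-vertex paths of length $0$ are included). *)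

(* Defs.v *)
From mathcomp Require Import all_boot.

Set Implicit Arguments.
Unset Strict Implicit.
Unset Printing Implicit Defensive.

Record sgraph := SGraph {
  vertex :> finType;
  adj : rel vertex;
  adj_sym : symmetric adj;
  adj_irrefl : irreflexive adj }.

(* [:: x & p] is the vertex sequence of a path from x to y; its length,
   counted in edges, is [size p]. *)
Definition gpath (G : sgraph) (x y : G) (p : seq G) : bool :=
  [&& path (@adj G) x p, uniq (x :: p) & last x p == y].

Definition gconnected (G : sgraph) : Prop :=
  forall x y : G, connect (@adj G) x y.

(* A path has fewer than #|G| edges, so this is the length of a shortest path,
   and the junk value #|G| when x and y are in different components. *)
Definition gdist (G : sgraph) (x y : G) : nat :=
  find (fun n => [exists p : n.-tuple G, gpath x y p]) (iota 0 #|G|).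

(* Least r such that some vertex is at distance at most r from all vertices;
   meaningful for connected nonempty G, where it is less than #|G|. *)
Definition gradius (G : sgraph) : nat :=
  find (fun r => [exists x : G, [forall y : G, gdist x y <= r]])
       (iota 0 #|G|).

Section Induced.
Variables (G : sgraph) (X : {set G}).

Definition induced_adj : rel {x : G | x \in X} :=
  fun x y => adj (val x) (val y).

Lemma induced_adj_sym : symmetric induced_adj.
Proof. by move=> x y; rewrite /induced_adj adj_sym. Qed.

Lemma induced_adj_irrefl : irreflexive induced_adj.
Proof. by move=> x; rewrite /induced_adj adj_irrefl. Qed.

Definition induced : sgraph := SGraph induced_adj_sym induced_adj_irrefl.
End Induced.

Section Quotient.
Variables (G : sgraph) (P : {set {set G}}).

Definition quotient_adj : rel {X : {set G} | X \in P} :=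
  fun X Y => (X != Y) &&
    [exists x : G, exists y : G, [&& x \in val X, y \in val Y & adj x y]].

Lemma quotient_adj_sym : symmetric quotient_adj.
Proof.
move=> X Y; rewrite /quotient_adj eq_sym; congr andb.
by apply/existsP/existsP => -[x /existsP[y /and3P[xX yY xy]]];
   exists y; apply/existsP; exists x; rewrite xX yY adj_sym.
Qed.

Lemma quotient_adj_irrefl : irreflexive quotient_adj.
Proof. by move=> X; rewrite /quotient_adj eqxx. Qed.

Definition quotient_graph : sgraph :=
  SGraph quotient_adj_sym quotient_adj_irrefl.
End Quotient.

(* H is isomorphic to a subgraph of K, not necessarily an induced one: f is an
   isomorphism onto the subgraph formed by the images of the vertices and
   edges of H. *)
Definition subgraph_iso (H K : sgraph) : Prop :=
  exists2 f : H -> K, injective f & forall u v : H, adj u v -> adj (f u) (f v).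

(* [partition] already requires the parts to be nonempty. *)
Definition depth_minor (r : nat) (H G : sgraph) : Prop :=
  exists P : {set {set G}},
    [/\ partition P [set: G],
        forall X : {set G}, X \in P ->
          gconnected (induced X) /\ gradius (induced X) <= r
      & subgraph_iso H (quotient_graph P)].

Definition nowhere_dense (C : sgraph -> Prop) : Prop :=
  forall r : nat, exists H : sgraph,
    forall G : sgraph, C G -> ~ depth_minor r H G.

(* Paths are undirected, so orienting them from A to B loses nothing. *)
Definition separates (d : nat) (G : sgraph) (S A B : {set G}) : Prop :=
  forall (x y : G) (p : seq G),
    x \in A -> y \in B -> gpath x y p -> size p <= d ->
    exists2 z : G, z \in x :: p & z \in S.

(* Main.v *)
(* Fix a small delta and write n for |A \cup B|.

   Contracting stars shows that a graph with N vertices and more than N^(1+delta)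
   edges has every small complete graph as a shallow minor: while no clique
   appears, the number of vertices drops by a factor close to the average degree,
   which hardly changes.  Hence all shallow minors of graphs from the class have
   degeneracy at most N^delta, and this gives an order of the vertices in which
   every weak r-reachability set has at most N^delta elements.  Sunflower-like
   kernels of the families of short paths between two vertices allow us to replace
   G by a subgraph with N polynomial in n.

   Call the vertices weakly d-reachable from v the hubs of v.  A path of length at
   most d between a and b contains a common hub of a and b, and of two hubs of b
   the smaller one is weakly 2d-reachable from the larger one.  Put
   X_0 = V(G), and let X_(i+1) consist of those m in X_i that are weakly
   2d-reachable from many vertices of X_i; then X_s is empty for some s that does
   not depend on G.  For each i, split B into classes according to the largest hub
   x of b in X_i.  A vertex a shares hubs outside X_(i+1) with few of these
   classes, so few classes are bad in the sense of sharing such hubs with a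
   positive proportion of A; S consists of the vertices weakly 2d-reachable from
   the x of the bad classes.  Every b whose hubs are not all in S belongs, for
   some i, to a class that is not bad, while its hubs in X_(i+1) are in S.  These
   classes are grouped into few bins, each of which shares hubs outside S with
   only a small proportion of A, and B' is the largest bin. *)

Require Import Defs.
From mathcomp Require Import all_boot all_order all_algebra.
From mathcomp Require Import reals exp.
From mathcomp Require Import boolp zify.

Set Implicit Arguments.
Unset Strict Implicit.
Unset Printing Implicit Defensive.

(** * Shallow minors *)

Section Walks.
Variables (V : finType) (e : rel V).
Implicit Types (Z : {set V}) (x y z : V) (n : nat).

(* Walks of length at most [n] from [x] to [y] whose vertices, except possibly
   [x], lie in [Z]. *)
Fixpoint walk (Z : {set V}) n (x y : V) : bool :=
  (x == y) ||
  (if n is n'.+1 then [exists z, [&& z \in Z, e x z & walk Z n' z y]] else false).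

Lemma walkxx Z n x : walk Z n x x.
Proof. by case: n => [|n] /=; rewrite eqxx. Qed.

Lemma walk0 Z x y : walk Z 0 x y -> x = y.
Proof. by rewrite /= orbF => /eqP. Qed.

Lemma walkSP Z n x y :
  walk Z n.+1 x y <-> x = y \/ exists z, [/\ z \in Z, e x z & walk Z n z y].
Proof.
split=> /= [/orP[/eqP->|/existsP[z /and3P[zZ xz zy]]]|[->|[z [zZ xz zy]]]].
- by left.
- by right; exists z.
- by rewrite eqxx.
- by apply/orP; right; apply/existsP; exists z; rewrite zZ xz zy.
Qed.

Lemma walk_step Z n x z y : z \in Z -> e x z -> walk Z n z y -> walk Z n.+1 x y.
Proof. by move=> zZ xz zy; apply/walkSP; right; exists z. Qed.

Lemma walk_sub (Z Z' : {set V}) m n x y :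
  Z \subset Z' -> m <= n -> walk Z m x y -> walk Z' n x y.
Proof.
move=> ZZ'; elim: m n x => [|m IHm] [|n] x // mn; rewrite ?ltnS // in mn *.
  by move=> /walk0->; apply: walkxx.
move=> /walkSP[->|[z [zZ xz zy]]]; first exact: walkxx.
by apply: (walk_step (z := z)) => //; [apply: (subsetP ZZ') | apply: IHm].
Qed.

Lemma walk_mem Z n x y : walk Z n x y -> x = y \/ y \in Z.
Proof.
elim: n x => [|n IHn] x; first by move=> /walk0; left.
move=> /walkSP[->|[z [zZ xz /IHn[<-|]]]]; by [left|right].
Qed.

Lemma walk_cat Z m n x y z : walk Z m x y -> walk Z n y z -> walk Z (m + n) x z.
Proof.
elim: m x => [|m IHm] x; first by move=> /walk0->.
move=> /walkSP[->|[u [uZ xu uy]]] yz.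
  by apply: walk_sub yz => //; apply: leq_addl.
by rewrite addSn; apply: (walk_step (z := u)) => //; apply: IHm.
Qed.

Lemma walk1 Z x y : y \in Z -> e x y -> walk Z 1 x y.
Proof. by move=> yZ xy; apply: (walk_step (z := y)) => //; apply: walkxx. Qed.

Lemma walk_rev Z n x y : symmetric e -> x \in Z -> walk Z n x y -> walk Z n y x.
Proof.
move=> e_sym; elim: n x => [|n IHn] x xZ.
  by move=> /walk0->; apply: walkxx.
move=> /walkSP[->|[z [zZ xz zy]]]; first exact: walkxx.
rewrite -addn1; apply: (@walk_cat Z n 1 y z x); first exact: IHn.
by apply: walk1 => //; rewrite e_sym.
Qed.

Lemma walk_path (Z : {set V}) x p :
  path e x p -> {subset p <= Z} -> walk Z (size p) x (last x p).
Proof.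
elim: p x => [|y p IHp] x /=; first by rewrite eqxx.
move=> /andP[xy yp] pZ; apply: (walk_step (z := y)) => //.
  by apply: pZ; rewrite inE eqxx.
by apply: IHp => // z zp; apply: pZ; rewrite inE zp orbT.
Qed.

(** Each vertex of [Q] is reached from [x] inside [Q], so a branch set centred at [x] can absorb
    [Q], gaining at most [n] vertices and keeping radius [n]. *)
Lemma walk_trace Z n x y :
  walk Z n x y ->
  exists Q : {set V}, [/\ Q \subset Z, #|Q| <= n, walk Q n x y
    & forall q, q \in Q -> walk Q n x q].
Proof.
elim: n x => [|n IHn] x.
  move=> /walk0->; exists set0.
  by rewrite sub0set cards0 walkxx; split=> // q; rewrite inE.
move=> /walkSP[->|[z [zZ xz /IHn[Q [QZ Qn Qzy Qz]]]]].
  exists set0.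
  by rewrite sub0set cards0 walkxx; split=> // q; rewrite inE.
have QzQ : Q \subset z |: Q by apply: subsetUr.
exists (z |: Q); split.
- by rewrite subUset sub1set zZ.
- by rewrite cardsU1; case: (z \notin Q) => /=; lia.
- apply: (walk_step (z := z)) => //; first by rewrite !inE eqxx.
  exact: walk_sub Qzy.
move=> q; rewrite in_setU1 => /orP[/eqP->|qQ];
  apply: (walk_step (z := z)) => //; rewrite ?inE ?eqxx ?walkxx //.
exact: walk_sub (Qz _ qQ).
Qed.

Lemma walk_first_hit (Z P : {set V}) n x y :
  walk Z n x y -> y \in P -> x \notin P ->
  exists u v, [/\ walk (Z :\: P) n x u, v \in P & e u v].
Proof.
elim: n x => [|n IHn] x; first by move=> /walk0-> ->.
move=> /walkSP[-> -> //|[z [zZ xz zy]]] yP xP.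
have [zP|zP] := boolP (z \in P); first by exists x, z; rewrite walkxx.
have [u [v [zu vP uv]]] := IHn z zy yP zP.
exists u, v; split=> //; apply: (walk_step (z := z)) => //.
by rewrite inE zP.
Qed.

Lemma walk_avoid (Z F : {set V}) n x y :
  walk Z n x y -> ~~ walk (Z :\: F) n x y ->
  exists f, [/\ f \in F, f \in Z & walk Z n.-1 f y].
Proof.
elim: n x => [|n IHn] x; first by move=> /walk0->; rewrite walkxx.
move=> /walkSP[->|[z [zZ xz zy]]]; first by rewrite walkxx.
move=> nxy; have [zF|zF] := boolP (z \in F); first by exists z.
have [|f [fF fZ fy]] := IHn z zy.
  apply: contraNN nxy => zy'; apply: (walk_step (z := z)) => //.
  by rewrite inE zF.
by exists f; split=> //; apply: walk_sub fy => //; apply: leq_pred.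
Qed.

End Walks.

Section Minors.
Variable V : finType.
Implicit Types (X Y : {set V}) (e : rel V).

(* The graph [(X', e')] is a depth-[r] minor of [(X, e)]; its vertices are
   identified with the centres of their branch sets, so that all minors of a
   graph live on the same vertex type. *)
Definition minor r X e X' e' := exists B : V -> {set V},
  [/\ X' \subset X,
      forall x, x \in X' ->
        [/\ x \in B x, B x \subset X & forall y, y \in B x -> walk e (B x) r x y],
      forall x y, x \in X' -> y \in X' -> x != y -> [disjoint B x & B y]
    & forall x y, x \in X' -> y \in X' -> x != y -> e' x y ->
        exists u v, [/\ u \in B x, v \in B y & e u v]].

(** [T r] bounds the order of complete depth-[r] minors, so that later constants can depend on [T]
    instead of the graph. *)
Definition sparse (T : nat -> nat) X e := forall r (K : {set V}),
  T r <= #|K| -> ~ minor r X e K (fun _ _ => true).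

Lemma minor_sub r X e X' X'' e' e'' :
  X'' \subset X' ->
  (forall x y, x \in X'' -> y \in X'' -> x != y -> e'' x y -> e' x y) ->
  minor r X e X' e' -> minor r X e X'' e''.
Proof.
move=> sX se [B [X'X BX Bd Be]]; have sXP := subsetP sX.
exists B; split; first exact: subset_trans X'X.
- by move=> x /sXP/BX.
- by move=> x y /sXP xX /sXP yX; apply: Bd.
by move=> x y xX yX xy /(se _ _ xX yX xy); apply: Be => //; apply: sXP.
Qed.

Lemma minor0 X e X' : X' \subset X -> minor 0 X e X' e.
Proof.
move=> sX; exists (fun x => [set x]); split=> // [x xX'|x y _ _|x y _ _ _ xy].
- split; rewrite ?set11 ?sub1set ?(subsetP sX) // => y /set1P->.
  exact: walkxx.
- by move=> xy; rewrite disjoints1 inE.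
- by exists x, y; rewrite !set11.
Qed.

(** Each step between centres costs [r] inside one branch set, one edge, and [r] inside the next; a
    last [r] leads from the final centre to the target. *)
Lemma minor_trans r s X e X1 e1 X2 e2 : symmetric e ->
  minor r X e X1 e1 -> minor s X1 e1 X2 e2 ->
  minor (s * (2 * r + 1) + r) X e X2 e2.
Proof.
move=> e_sym [B [X1X BX Bd Be]] [B' [X2X B'X B'd B'e]].
pose U x := \bigcup_(y in B' x) B y.
have X2X1 := subsetP X2X.
have B'X1 x y : x \in X2 -> y \in B' x -> y \in X1.
  by move=> /B'X[_ /subsetP sB _] /sB.
have BU x y : y \in B' x -> B y \subset U x by move=> yB; apply: bigcup_sup.
exists U; split; first exact: subset_trans X1X.
- move=> x xX2; have [xB' B'xX1 B'r] := B'X _ xX2.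
  split.
  + apply/bigcupP; exists x => //.
    by have [] := BX x (X2X1 _ xX2).
  + apply/bigcupsP => y /(B'X1 _ _ xX2)/BX[]; by [].
  move=> z /bigcupP[y yB' zBy].
  have [yBy _ Bry] := BX y (B'X1 _ _ xX2 yB').
  have {Bry} yz : walk e (U x) r y z by apply: walk_sub (Bry _ zBy) => //; apply: BU.
  suff H n : n <= s -> forall u, u \in B' x -> walk e1 (B' x) n u y ->
      walk e (U x) (n * (2 * r + 1)) u y.
    by apply: walk_cat yz; apply: H => //; apply: B'r.
  elim: n => [|n IHn] ns u uB'; first by move=> /walk0->; apply: walkxx.
  have uX1 := B'X1 _ _ xX2 uB'.
  move=> /walkSP[->|[v [vB' uv vy]]]; first exact: walkxx.
  have vX1 := B'X1 _ _ xX2 vB'.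
  have {IHn}vy := IHn (ltnW ns) v vB' vy.
  (* [e1] need not be irreflexive; a loop is skipped, since [minor] realises only edges between
     distinct vertices. *)
  have [<-|nuv] := eqVneq v u.
    by apply: walk_sub vy => //; rewrite leq_mul2r leqnSn orbT.
  rewrite eq_sym in nuv.
  have [p [q [pB qB pq]]] := Be u v uX1 vX1 nuv uv.
  rewrite mulSn; apply: walk_cat vy.
  have [_ _ Bru] := BX u uX1; have [vBv _ Brv] := BX v vX1.
  rewrite mul2n -addnn -addnA (addnC r 1).
  apply: (@walk_cat _ _ _ _ _ _ p).
    by apply: walk_sub (Bru _ pB) => //; apply: BU.
  apply: (@walk_cat _ _ _ _ _ _ q).
    by apply: walk1 => //; apply: (subsetP (BU x v vB')).
  apply: walk_sub (BU x v vB') (leqnn r) _.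
  by apply: walk_rev => //; apply: Brv.
- move=> x y xX2 yX2 xy; apply/pred0P => z /=; apply/negP => /andP[].
  move=> /bigcupP[u uB zu] /bigcupP[v vB zv].
  have [uv|uv] := eqVneq u v.
    have := B'd x y xX2 yX2 xy; rewrite disjoint_subset => /subsetP/(_ u uB).
    by rewrite inE uv vB.
  have := Bd u v (B'X1 _ _ xX2 uB) (B'X1 _ _ yX2 vB) uv.
  by rewrite disjoint_subset => /subsetP/(_ z zu); rewrite inE zv.
move=> x y xX2 yX2 xy exy.
have [u [v [uB vB uv]]] := B'e x y xX2 yX2 xy exy.
have nuv : u != v.
  apply: contraTneq uB => ->.
  have := B'd x y xX2 yX2 xy; rewrite disjoint_sym disjoint_subset.
  by move=> /subsetP/(_ v vB); rewrite inE.
have [p [q [pB qB pq]]] :=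
  Be u v (B'X1 _ _ xX2 uB) (B'X1 _ _ yX2 vB) nuv uv.
by exists p, q; split=> //; apply/bigcupP; [exists u | exists v].
Qed.

Lemma sparse_minor T s X e X1 e1 : symmetric e ->
  sparse T X e -> minor s X e X1 e1 ->
  sparse (fun r => T (r * (2 * s + 1) + s)) X1 e1.
Proof.
by move=> e_sym Xsp X1m r K TK Km; apply: Xsp TK _; apply: minor_trans Km.
Qed.

End Minors.

(** * Sparse graphs are degenerate *)

Lemma leq_expn2r m n k : m <= n -> m ^ k <= n ^ k.
Proof. by case: k => [|k] mn //; rewrite leq_exp2r. Qed.

Lemma leq_expn_self m k : 0 < k -> m <= m ^ k.
Proof.
by case: m k => [|m] [|k] // _; rewrite expnS leq_pmulr // expn_gt0.
Qed.

Lemma leq_card_bigcup (I T : finType) (J : {set I}) (A : I -> {set T}) :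
  #|\bigcup_(i in J) A i| <= \sum_(i in J) #|A i|.
Proof.
apply: (big_ind2 (fun (U : {set T}) n => #|U| <= n)) => [|U m U' n Um U'n|//].
  by rewrite cards0.
by apply: leq_trans (leq_card_setU _ _) _; apply: leq_add.
Qed.

Lemma sum_card_rel (I J : finType) (A : {set I}) (B : {set J}) (R : I -> J -> bool) :
  \sum_(i in A) #|[set j in B | R i j]| = \sum_(j in B) #|[set i in A | R i j]|.
Proof.
under eq_bigr do rewrite -sum1_card big_mkcond.
rewrite (eq_bigr (fun i => \sum_(j in B) (if R i j then 1 else 0))); last first.
  move=> i _; rewrite [RHS]big_mkcond /=; apply: eq_bigr => j _.
  by rewrite inE; case: (j \in B).
rewrite exchange_big /=; apply: eq_bigr => j _.
rewrite -sum1_card [RHS]big_mkcond [LHS]big_mkcond /=; apply: eq_bigr => i _.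
by rewrite inE; case: (i \in A).
Qed.

Section Degeneracy.
Variable V : finType.
Implicit Types (X Y A : {set V}) (e h : rel V).

Definition nb e X x := [set y in X | e x y].

Definition degenerate d X e := forall X', X' \subset X -> X' != set0 ->
  exists2 x, x \in X' & #|nb e X' x| <= d.

Lemma sum_nb_sym e X Y : symmetric e ->
  \sum_(x in X) #|nb e Y x| = \sum_(y in Y) #|nb e X y|.
Proof.
move=> e_sym; rewrite sum_card_rel; apply: eq_bigr => y _.
by apply: eq_card => x; rewrite !inE e_sym.
Qed.

Lemma sum_nb_pairs e X :
  \sum_(x in X) #|nb e X x| =
  #|[set p : V * V | (p.1 \in X) && (p.2 \in nb e X p.1)]|.
Proof.
rewrite -sum1_card (eq_bigl _ _ (fun p => in_set _ p)) /=.
rewrite -(pair_big_dep (mem X) (fun x y => y \in nb e X x) (fun _ _ => 1)) /=.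
by apply: eq_bigr => x _; rewrite sum1_card.
Qed.

Lemma degenerate_edges d X e : symmetric e -> degenerate d X e ->
  \sum_(x in X) #|nb e X x| <= 2 * d * #|X|.
Proof.
move=> e_sym; have [m] := ubnP #|X|; elim: m X => // m IHm X Xm Xd.
have [->|X0] := eqVneq X set0; first by rewrite big_set0.
have [x xX dx] := Xd X (subxx _) X0.
pose X' := X :\ x.
have cX : #|X| = #|X'|.+1 by rewrite (cardsD1 x) xX.
have X'X : X' \subset X by apply: subD1set.
rewrite (big_setD1 x xX) /=.
have nbX y : #|nb e X y| = #|nb e X' y| + #|nb e [set x] y|.
  have I0 : nb e X' y :&: nb e [set x] y = set0.
    by apply/setP => z; rewrite !inE; case: (z == x); rewrite ?andbF.
  rewrite -cardsUI I0 cards0 addn0.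
  apply: eq_card => z; rewrite !inE; case: (eqVneq z x) => [->|_] /=.
    by rewrite xX.
  by rewrite orbF.
under eq_bigr do rewrite nbX.
rewrite big_split /= (sum_nb_sym _ [set x] e_sym) big_set1.
have IH : \sum_(x in X') #|nb e X' x| <= 2 * d * #|X'|.
  apply: IHm; first by rewrite cX in Xm.
  by move=> Y YX'; apply: Xd; apply: subset_trans X'X.
have le1 : #|nb e X' x| <= d.
  apply: leq_trans dx; apply/subset_leq_card/subsetP => y.
  by rewrite !inE => /andP[/andP[_ ->]].
rewrite /X' in IH le1 cX *; nia.
Qed.

Lemma degenerate_independent d X e : symmetric e -> degenerate d X e ->
  exists I : {set V}, [/\ I \subset X, #|X| <= d.+1 * #|I|
    & {in I &, forall x y, x != y -> ~~ e x y}].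
Proof.
move=> e_sym; have [m] := ubnP #|X|; elim: m X => // m IHm X Xm Xd.
have [->|X0] := eqVneq X set0.
  by exists set0; rewrite sub0set cards0; split=> // x y; rewrite inE.
have [x xX dx] := Xd X (subxx _) X0.
pose X' := X :\: (x |: nb e X x).
have X'X : X' \subset X by apply: subsetDl.
have cX : #|X| <= #|X'| + d.+1.
  rewrite -(cardsID (x |: nb e X x) X) addnC leq_add2l.
  apply: leq_trans (subset_leq_card (subsetIr _ _)) _.
  by rewrite cardsU1; case: (x \notin _); rewrite /= ?add1n ?ltnS //; apply: leqW.
have xX' : x \notin X' by rewrite !inE eqxx.
have [||I [IX' cI Ii]] := IHm X'.
- rewrite ltnS in Xm; apply: leq_trans Xm; apply: proper_card.
  by rewrite properE X'X; apply: contra xX' => /subsetP; apply.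
- by move=> Y YX'; apply: Xd; apply: subset_trans X'X.
have xI : x \notin I by apply: contra xX'; apply: (subsetP IX').
have nxI y : y \in I -> ~~ e x y.
  move=> /(subsetP IX'); rewrite !inE negb_or negb_and.
  by case/andP=> /andP[_ /orP[/negP|//]].
exists (x |: I); split.
- by rewrite subUset sub1set xX (subset_trans IX').
- by rewrite cardsU1 xI /=; nia.
move=> y z; rewrite !inE => /orP[/eqP->|yI] /orP[/eqP->|zI].
- by rewrite eqxx.
- by move=> _; apply: nxI.
- by move=> _; rewrite e_sym; apply: nxI.
exact: Ii.
Qed.

(* Greedily adding a vertex adjacent to many deficient vertices raises the
   potential [\sum_x minn t #|nb e A x|], which is at most [t * #|X|]. *)
Lemma multiple_domination e X D t : symmetric e ->
  (forall x, x \in X -> D <= #|nb e X x|) -> 2 * t <= D ->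
  exists A, [/\ A \subset X, #|A| * D <= 4 * t * #|X|
    & #|X| <= 2 * #|[set x in X | t <= #|nb e A x|]|].
Proof.
move=> e_sym Xdeg tD.
pose Phi A := \sum_(x in X) minn t #|nb e A x|.
pose P A := (A \subset X) && (#|A| * D <= 4 * Phi A).
have P0 : P set0 by rewrite /P sub0set cards0.
have [A /andP[AX Acard] Amax] := @arg_maxnP _ set0 P (fun A => #|A|) P0.
exists A; split=> //.
  apply: leq_trans Acard _; rewrite -mulnA leq_mul2l /= mulnC -sum_nat_const.
  by apply: leq_sum => x _; apply: geq_minl.
set G := [set x in X | _].
rewrite leqNgt; apply/negP => GX.
pose Z := X :\: G.
have cZ : #|X| < 2 * #|Z|.
  have GsX : G \subset X by apply/subsetP => x; rewrite inE => /andP[].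
  have := cardsID G X; rewrite (setIidPr GsX) -/Z; lia.
have ZP x : x \in Z -> x \in X /\ #|nb e A x| < t.
  by rewrite !inE => /andP[nG xX]; rewrite xX /= -ltnNge in nG.
have D0 : 0 < D.
  case: (posnP D) tD => // -> ; rewrite leqn0 muln_eq0 /= => /eqP t0.
  have /card_gt0P[x /ZP[_]] : 0 < #|Z| by lia.
  by rewrite t0.
(* Vertices of [Z] have at least [D - t >= D / 2] neighbours outside [A], and [Z] is more than half
   of [X]; averaging gives [w] with at least [D / 4] neighbours in [Z]. *)
have [w wX wZ] : exists2 w, w \in X :\: A & D <= 4 * #|nb e Z w|.
  apply/exists_inP; apply: contraT; rewrite negb_exists_in => /forall_inP small.
  have up : 4 * \sum_(w in X :\: A) #|nb e Z w| <= #|X| * D.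
    rewrite big_distrr /=; apply: (@leq_trans (\sum_(w in X :\: A) D)).
      by apply: leq_sum => w /small; rewrite -ltnNge => /ltnW.
    rewrite sum_nat_const leq_mul2r.
    by rewrite (subset_leq_card (subsetDl _ _)) orbT.
  have lo : #|Z| * D <= 2 * \sum_(w in X :\: A) #|nb e Z w|.
    rewrite sum_nb_sym // big_distrr -sum_nat_const /=.
    apply: leq_sum => z /ZP[zX zA].
    have := Xdeg z zX.
    have -> : nb e X z = nb e (X :\: A) z :|: nb e A z.
      apply/setP => y; rewrite !inE; have := subsetP AX y.
      by case: (y \in A) => [->|_] //=; rewrite orbF.
    have [] := leq_card_setU (nb e (X :\: A) z) (nb e A z).
    lia.
  nia.
have /setDP[wX' wA] := wX.
suff : P (w |: A).
  by move/Amax; rewrite cardsU1 wA /= add1n ltnn.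
rewrite /P subUset sub1set wX' AX cardsU1 wA /=.
suff : Phi A + #|nb e Z w| <= Phi (w |: A) by nia.
have -> : #|nb e Z w| = \sum_(x in X) (x \in nb e Z w).
  rewrite -sum1_card big_mkcond [RHS]big_mkcond /=; apply: eq_bigr => x _.
  by rewrite !inE; case: (x \in X) => /=; rewrite ?andbF //; case: ifP.
rewrite -big_split /=; apply: leq_sum => x xX.
have sA : #|nb e A x| <= #|nb e (w |: A) x|.
  by apply/subset_leq_card/subsetP => y; rewrite !inE => /andP[-> ->]; rewrite orbT.
have [/setIdP[/ZP[_ xA] wx]|_] := boolP (x \in nb e Z w); last by rewrite addn0; lia.
have : #|w |: nb e A x| <= #|nb e (w |: A) x|.
  apply/subset_leq_card/subsetP => y; rewrite !inE => /orP[/eqP->|/andP[-> ->]].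
    by rewrite eqxx e_sym.
  by rewrite orbT.
rewrite cardsU1 inE (negPf wA) /=; lia.
Qed.

(* Each vertex of [Bs] in turn is contracted into a neighbour in [A] so as to
   create a new edge; if this is impossible then its neighbours in [A] already
   form a clique. *)
Lemma clique_or_dense_minor e X A (Bs : {set V}) t : symmetric e ->
  A \subset X -> Bs \subset X -> [disjoint A & Bs] ->
  (forall v, v \in Bs -> t <= #|nb e A v|) ->
  (forall K : {set V}, t <= #|K| -> ~ minor 1 X e K (fun _ _ => true)) ->
  exists h, [/\ symmetric h, minor 1 X e A h
    & #|Bs| <= \sum_(a in A) #|nb h A a|].
Proof.
move=> e_sym AX BX AB Bdeg noK.
have AB' v : v \in A -> v \in Bs -> False.
  by move=> vA vB; move: AB; rewrite disjoint_subset => /subsetP/(_ v vA);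
    rewrite inE vB.
(* [g v = Some (a, b)] will mean that [v] is contracted into [a] to create the edge between [a] and
   [b]; no ordered pair is used twice. *)
pose ok (v : V) (p : V * V) :=
  [&& v \in Bs, p.1 \in A, p.2 \in A, p.1 != p.2, e v p.1 & e v p.2].
pose valid (g : {ffun V -> option (V * V)}) :=
  [forall v, if g v is Some p then
     ok v p && [forall u, (g u == Some p) ==> (u == v)] else true].
have [g gval gmax] := @arg_maxnP _ [ffun=> None] valid
  (fun g => #|[set v | g v != None]|)
  ltac:(by apply/forallP => v; rewrite ffunE).
have gP v p : g v = Some p -> ok v p /\ forall u, g u = Some p -> u = v.
  move=> gv; have /forallP/(_ v) := gval; rewrite gv => /andP[okv /forallP inj].
  by split=> // u gu; have /implyP/(_ (introT eqP gu))/eqP := inj u.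
pose h a b := [exists v, (g v == Some (a, b)) || (g v == Some (b, a))].
have h_sym : symmetric h.
  by move=> a b; apply: eq_existsb => v; rewrite orbC.
have hm : minor 1 X e A h.
  exists (fun a => a |: [set v | if g v is Some p then p.1 == a else false]).
  split=> //.
  - move=> a aA; split; first by rewrite !inE eqxx.
      rewrite subUset sub1set (subsetP AX) //=; apply/subsetP => v.
      rewrite inE; case gv: (g v) => [p|] // _.
      by have [/and5P[/(subsetP BX)]] := gP _ _ gv.
    move=> v; rewrite in_setU1 => /orP[/eqP->|vB]; first exact: walkxx.
    apply: walk1; first by rewrite in_setU1 vB orbT.
    move: vB; rewrite inE; case gv: (g v) => [p|] // /eqP<-.
    by have [/and5P[_ _ _ _ /andP[]]] := gP _ _ gv; rewrite e_sym.
  - move=> a b aA bA ab; apply/pred0P => v; rewrite !inE /=.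
    case gv: (g v) => [p|] /=; last first.
      by rewrite !orbF; apply: contraNF ab => /andP[/eqP<- /eqP<-].
    have [/and5P[vB _ _ _ _] _] := gP _ _ gv.
    have va c : c \in A -> (v == c) = false.
      by move=> cA; apply/eqP => vc; apply: (AB' c) => //; rewrite -vc.
    rewrite !va //=; apply: contraNF ab => /andP[/eqP<- /eqP<-].
    by [].
  move=> a b aA bA ab /existsP[v /orP[] /eqP gv];
    have [/and5P[/= vB _ _ _ /andP[va vb]] _] := gP _ _ gv.
  - exists v, b; rewrite !inE eqxx gv eqxx orbT; split=> //.
  - exists a, v; rewrite !inE eqxx gv eqxx orbT; split=> //.
    by rewrite e_sym.
exists h; split=> //.
have gB v : v \in Bs -> g v != None.
  move=> vB; apply/negP => /eqP gv.
  apply: (noK (nb e A v)); first exact: Bdeg.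
  apply: minor_sub hm; first by apply/subsetP => x; rewrite inE => /andP[].
  move=> a b /setIdP[aA va] /setIdP[bA vb].
  move=> ab _; suff: is_true (h a b) by []. 
  apply: contraT => nhab.
  have nab : forall u, g u != Some (a, b).
    by move=> u; apply: contraNN nhab => gu; apply/existsP; exists u; rewrite gu.
  pose g' := [ffun u => if u == v then Some (a, b) else g u].
  have g'val : valid g'.
    apply/forallP => u; rewrite ffunE; have [->|uv] := eqVneq u v.
      rewrite /ok vB aA bA ab va vb /=; apply/forallP => w.
      by rewrite ffunE; case: (eqVneq w v) => _; rewrite ?implybT ?(negPf (nab w)).
    case gu: (g u) => [p|] //; have [-> inj] := gP _ _ gu.
    apply/forallP => w; rewrite ffunE; have [->|wv] := eqVneq w v.
      by apply/implyP => /eqP pab; have := nab u; rewrite gu pab eqxx.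
    by apply/implyP => /eqP/inj->.
  suff : #|[set u | g u != None]| < #|[set u | g' u != None]|.
    by rewrite ltnNge => /negP[]; apply: (gmax g' g'val).
  apply: proper_card; apply/properP; split.
    by apply/subsetP => u; rewrite !inE ffunE; case: ifP.
  by exists v; rewrite !inE ?ffunE ?eqxx ?gv.
pose f v := if g v is Some p then p else (v, v).
have f_inj : {in Bs &, injective f}.
  move=> u v /gB + /gB; rewrite /f.
  case gu: (g u) => [p|] // _; case gv: (g v) => [q|] // _ pq.
  by have [_ inj] := gP _ _ gv; apply: inj; rewrite gu pq.
rewrite -(card_in_imset f_inj) sum_nb_pairs.
apply/subset_leq_card/subsetP => _ /imsetP[v /gB vB ->].
rewrite /f; case gv: (g v) vB => [[a b]|] // _.
have [/and5P[/= _ aA bA _ _] _] := gP _ _ gv.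
by rewrite !inE /= aA bA; apply/existsP; exists v; rewrite gv eqxx.
Qed.
End Degeneracy.

Lemma sparse_sub (V : finType) T (X X' : {set V}) e :
  symmetric e -> X' \subset X -> sparse T X e -> sparse T X' e.
Proof.
move=> e_sym sX Xs r K TK Km; apply: (Xs r K TK).
have := minor_trans e_sym (minor0 e sX) Km.
by rewrite muln0 add0n muln1 addn0.
Qed.

Lemma degenerate_of_degree (V : finType) (X : {set V}) e j C :
  X != set0 ->
  (forall X' : {set V}, X' \subset X -> X' != set0 ->
    exists2 x, x \in X' & #|nb e X' x| ^ j.+1 <= C * #|X'|) ->
  exists2 d, d ^ j.+1 <= C * #|X| & degenerate d X e.
Proof.
move=> X0 H.
have ex0 : exists d, d ^ j.+1 <= C * #|X| by exists 0; rewrite exp0n.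
have bd d : d ^ j.+1 <= C * #|X| -> d <= C * #|X|.
  exact/leq_trans/leq_expn_self.
have [d dC dmax] := ex_maxnP ex0 bd.
exists d => // X' X'X X'0; have [x xX' dx] := H X' X'X X'0.
exists x => //; apply: dmax; apply: leq_trans dx _.
by rewrite leq_mul2l (subset_leq_card X'X) orbT.
Qed.

(* Each round replaces [X] by a set [A] smaller by a factor of the order of the
   minimum degree [D], while the average degree stays of the order of [D];
   hence [j] rounds bound [D ^ j] by [#|X|]. *)
Lemma sparse_degree j T : exists C, forall (V : finType) (X : {set V}) e,
  symmetric e -> sparse T X e -> X != set0 ->
  exists2 x, x \in X & #|nb e X x| ^ j.+1 <= C * #|X|.
Proof.
elim: j T => [|j IHj] T.
  exists 1 => V X e _ _ /set0Pn[x xX]; exists x => //.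
  by rewrite expn1 mul1n; apply/subset_leq_card/subsetP => y; rewrite inE => /andP[].
have [C' HC'] := IHj (fun r => T (r * (2 * 1 + 1) + 1)).
pose t := T 1.
(* The first summand covers minimum degree at most [16 * t]. Above that, [A] is at most a quarter of
   [X], which leaves at least a quarter for [B]. *)
exists ((16 * t).+1 ^ j.+2 + 8 ^ j.+1 * C' * (4 * t) ^ j.+2).
move=> V X e e_sym Xs /set0Pn[x0 x0X].
have X_gt0 : 0 < #|X| by apply/card_gt0P; exists x0.
have [x xX xmin] := @arg_minnP _ x0 (mem X) (fun x => #|nb e X x|) x0X.
exists x => //; set D := #|nb e X x| in xmin *.
have [Dt|tD] := leqP D (16 * t).
  apply: (@leq_trans ((16 * t).+1 ^ j.+2)).
    by rewrite leq_exp2r // ltnW.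
  by rewrite mulnDl; apply: leq_trans (leq_addr _ _); rewrite leq_pmulr.
have tD2 : 2 * t <= D by lia.
have [A [AX Acard Xcard]] := multiple_domination e_sym xmin tD2.
set G := [set x in X | _] in Xcard.
pose B := G :\: A.
have GX : G \subset X by apply/subsetP => y; rewrite inE => /andP[].
have BX : B \subset X by apply: subset_trans GX; apply: subsetDl.
have cA : 4 * #|A| <= #|X|.
  have : 4 * #|A| * D <= D * #|X| by nia.
  by rewrite mulnC leq_pmul2l //; lia.
have cB : #|X| <= 4 * #|B|.
  have := cardsID A G; have := subset_leq_card (subsetIr G A); rewrite -/B; lia.
have [|v|K Kt|h [h_sym hm hB]] := @clique_or_dense_minor _ e X A B t e_sym AX BX.
- by rewrite disjoint_sym disjoint_subset; apply/subsetP => y; rewrite !inE => /andP[].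
- by rewrite !inE => /andP[_ /andP[]].
- exact: Xs.
have A0 : A != set0.
  by apply: contraTneq hB => A0; rewrite A0 big_set0; lia.
have As := sparse_minor e_sym Xs hm.
have [|d dC dA] := @degenerate_of_degree _ A h j C' A0.
  move=> X' X'A X'0; apply: HC' => //.
  exact: sparse_sub As.
have Xd : #|X| <= 8 * d * #|A|.
  have := degenerate_edges h_sym dA; lia.
have X1 : #|X| ^ j.+1 <= 8 ^ j.+1 * C' * #|A| ^ j.+2.
  apply: (@leq_trans ((8 * d * #|A|) ^ j.+1)); first by rewrite leq_exp2r.
  rewrite !expnMn [#|A| ^ j.+2]expnSr -!mulnA leq_mul2l expn_eq0 /=.
  rewrite [#|A| ^ _ * #|A|]mulnC mulnA leq_mul2r expn_eq0.
  by apply/orP; right.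
have A1 : (#|A| * D) ^ j.+2 <= (4 * t) ^ j.+2 * #|X| ^ j.+2.
  by rewrite -expnMn leq_exp2r.
rewrite mulnDl; apply: leq_trans (leq_addl _ _).
(* [X1] comes from the induction hypothesis on [A] and [A1] from the domination; eliminating [#|A|]
   leaves the common factor [#|X| ^ j.+1] to cancel. *)
have : #|X| ^ j.+1 * D ^ j.+2 <= #|X| ^ j.+1 * (8 ^ j.+1 * C' * (4 * t) ^ j.+2 * #|X|).
  apply: (@leq_trans (8 ^ j.+1 * C' * #|A| ^ j.+2 * D ^ j.+2)).
    by rewrite leq_mul2r X1 orbT.
  rewrite -mulnA -expnMn.
  apply: (@leq_trans (8 ^ j.+1 * C' * ((4 * t) ^ j.+2 * #|X| ^ j.+2))).
    by rewrite leq_mul2l A1 orbT.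
  by rewrite [#|X| ^ j.+2]expnS [leqRHS]mulnC !mulnA.
by rewrite leq_pmul2l // expn_gt0 X_gt0.
Qed.

Lemma sparse_degenerate j T : exists C, forall (V : finType) (X : {set V}) e,
  symmetric e -> sparse T X e -> X != set0 ->
  exists2 d, d ^ j.+1 <= C * #|X| & degenerate d X e.
Proof.
have [C HC] := sparse_degree j T; exists C => V X e e_sym Xs X0.
apply: degenerate_of_degree X0 _ => X' X'X X'0; apply: HC => //.
exact: sparse_sub Xs.
Qed.

(** * Elimination orders *)

Section Cuts.
Variables (V : finType) (e : rel V) (Y X : {set V}) (r : nat).
Hypotheses (e_sym : symmetric e) (XY : X \subset Y).

Definition core (B : V -> {set V}) := \bigcup_(x in X) B x.

(* Branch sets centred at the vertices of [X] and realising the edges of [E]. *)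
Definition linkage (B : V -> {set V}) (E : {set V * V}) :=
  [/\ forall x, x \in X -> [/\ x \in B x, B x \subset Y,
        forall y, y \in B x -> y \in X -> y = x
        & forall y, y \in B x -> walk e (B x) r x y],
      forall x y, x \in X -> y \in X -> x != y -> [disjoint B x & B y],
      forall x y, (x, y) \in E -> [/\ x \in X, y \in X, x != y &
        exists u v, [/\ u \in B x, v \in B y & e u v]]
    & #|core B| <= #|X| + 2 * r * #|E|].

Lemma linkage0 : linkage (fun x => [set x]) set0.
Proof.
split=> [x xX|x y _ _ xy|x y|].
- rewrite set11 sub1set (subsetP XY) //; split=> // y /set1P-> //.
  exact: walkxx.
- by rewrite disjoints1 inE.
- by rewrite inE.
rewrite cards0 muln0 addn0.
by apply/subset_leq_card/subsetP=> x /bigcupP[y yX /set1P->].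
Qed.

Lemma core_sub B E x y : linkage B E -> x \in X -> y \in B x -> y \in core B.
Proof. by move=> _ xX yB; apply/bigcupP; exists x. Qed.

(** The walks meeting at [z] join the two branch sets: [x] takes the first walk, [y] the second one
    up to its first contact with the first. This adds at most [2 * r] vertices for the new edge. *)
Lemma linkage_extend B E x y z : linkage B E ->
  x \in X -> y \in X -> x != y -> (x, y) \notin E ->
  walk e (Y :\: core B) r x z -> walk e (Y :\: core B) r y z ->
  exists B', linkage B' ((x, y) |: E).
Proof.
move=> L xX yX xy xyE xz yz; have [BX Bd BE Bc] := L.
set O := Y :\: core B in xz yz.
have [Q [QO Qr Qxz Qx]] := walk_trace xz.
have OB u v : u \in O -> v \in X -> u \in B v -> False.
  by move=> /setDP[_ uC] vX uB; rewrite (core_sub L vX uB) in uC.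
have XO u : u \in X -> u \in O -> False.
  by move=> uX uO; apply: (OB u u) => //; have [] := BX u uX.
have yQ : y \notin x |: Q.
  rewrite in_setU1 negb_or eq_sym xy /=; apply/negP => yQ.
  by apply: (XO y) => //; apply: (subsetP QO).
have zQ : z \in x |: Q.
  by rewrite in_setU1; case: (walk_mem Qxz) => [->|->]; rewrite ?eqxx ?orbT.
have [w [u [yw uQ wu]]] := walk_first_hit yz zQ yQ.
have [P [PO Pr Pyw Py]] := walk_trace yw.
have PO' : P \subset O by apply: subset_trans PO (subsetDl _ _).
pose B' v := if v == x then B x :|: Q else if v == y then B y :|: P else B v.
have BB' v : B v \subset B' v.
  by rewrite /B'; case: eqVneq => [->|_]; [|case: eqVneq => [->|_]]; rewrite ?subsetUl.
have B'x : B' x = B x :|: Q by rewrite /B' eqxx.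
have B'y : B' y = B y :|: P by rewrite /B' eq_sym (negPf xy) eqxx.
have B'P v p : p \in B' v -> [\/ p \in B v, v = x /\ p \in Q | v = y /\ p \in P].
  rewrite /B'; case: eqVneq => [->|_]; [|case: eqVneq => [->|_]];
    rewrite ?in_setU; try case/orP; try by constructor 1.
  - by constructor 2.
  - by constructor 3.
have QP p : p \in Q -> p \in P -> False.
  by move=> pQ /(subsetP PO)/setDP[_]; rewrite in_setU1 pQ orbT.
exists B'; split.
- move=> v vX; have [vB BY BvX Bv] := BX v vX; split.
  + exact: (subsetP (BB' v)).
  + apply/subsetP => p /B'P[/(subsetP BY)//|[_ /(subsetP QO)]|[_ /(subsetP PO')]];
      by case/setDP.
  + move=> p /B'P[|[_ /(subsetP QO) pO]|[_ /(subsetP PO') pO]]; first exact: BvX.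
    * by move=> /XO/(_ pO).
    * by move=> /XO/(_ pO).
  move=> p /B'P[/Bv|[-> /Qx]|[-> /Py]].
  + exact: walk_sub.
  + by apply: walk_sub => //; rewrite B'x subsetUr.
  + by apply: walk_sub => //; rewrite B'y subsetUr.
- move=> a b aX bX ab; apply/pred0P => p /=; apply/negP => /andP[].
  have BBF : p \in B a -> p \in B b -> False.
    move=> pa pb; have := Bd a b aX bX ab.
    by rewrite disjoint_subset => /subsetP/(_ p pa); rewrite inE pb.
  move=> /B'P[pa|[ax pQ]|[ay pP]] /B'P[pb|[bx pQ']|[by_ pP']].
  + exact: BBF.
  + by apply: (OB p a) => //; apply: (subsetP QO).
  + by apply: (OB p a) => //; apply: (subsetP PO').
  + by apply: (OB p b) => //; apply: (subsetP QO).
  + by move: ab; rewrite ax bx eqxx.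
  + exact: QP pP'.
  + by apply: (OB p b) => //; apply: (subsetP PO').
  + exact: QP pP.
  + by move: ab; rewrite ay by_ eqxx.
- move=> a b; rewrite in_setU1 => /orP[/eqP[-> ->]|/BE[aX bX ab [p [q [pB qB pq]]]]].
    split=> //; exists u, w; split; last by rewrite e_sym.
      rewrite B'x; move: uQ; rewrite in_setU1 in_setU => /orP[/eqP->|->].
        by have [->] := BX x xX.
      by rewrite orbT.
    rewrite B'y in_setU; case: (walk_mem Pyw) => [<-|->]; last by rewrite orbT.
    by have [->] := BX y yX.
  by split=> //; exists p, q; split=> //; apply: (subsetP (BB' _)).
rewrite cardsU1 xyE /=.
have : core B' \subset core B :|: (Q :|: P).
  apply/subsetP => p /bigcupP[v vX /B'P[pv|[_ pQ]|[_ pP]]]; rewrite !inE.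
  - by rewrite (core_sub L vX pv).
  - by rewrite pQ orbT.
  - by rewrite pP !orbT.
move=> /subset_leq_card cB'.
have [cBU _] := leq_card_setU (core B) (Q :|: P).
have [cQP _] := leq_card_setU Q P.
rewrite mulnDr muln1 mul2n -addnn mulnDl addnCA addnC.
apply: (leq_trans cB'); apply: (leq_trans cBU); apply: leq_add.
  by rewrite -mulnDl addnn -mul2n.
by apply: (leq_trans cQP); apply: leq_add.
Qed.

Lemma maximal_linkage : exists B E, linkage B E /\
  forall x y z, x \in X -> y \in X -> x != y -> (x, y) \notin E ->
  walk e (Y :\: core B) r x z -> walk e (Y :\: core B) r y z -> False.
Proof.
pose P m := `[< exists B E, linkage B E /\ #|E| = m >].
have exP : exists m, P m.
  exists 0; apply/asboolP; exists (fun x => [set x]), set0.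
  by rewrite cards0; split=> //; apply: linkage0.
have bP m : P m -> m <= #|{: V * V}|.
  by move=> /asboolP[B [E [_ <-]]]; apply: max_card.
have [m /asboolP[B [E [L cE]]] mmax] := ex_maxnP exP bP.
exists B, E; split=> // x y z xX yX xy xyE xz yz.
have [B' L'] := linkage_extend L xX yX xy xyE xz yz.
have /mmax : P #|(x, y) |: E| by apply/asboolP; exists B', ((x, y) |: E).
by rewrite cardsU1 xyE cE /= add1n ltnn.
Qed.

(* Take a maximal linkage [(B, E)].  Balls around vertices that are nonadjacent
   in [E], taken outside the branch sets, are disjoint, so contracting the balls
   around an independent set [I] that contains a fixed proportion of [X] gives a
   minor in which the degrees of the vertices of [I] are the sizes of the
   boundaries of their balls; the boundary of a ball is the required cut. *)
Lemma small_cut d :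
  X != set0 ->
  (forall X' e', X' != set0 -> symmetric e' -> minor r Y e X' e' ->
     degenerate d X' e') ->
  exists v (F : {set V}), [/\ v \in X, v \notin F,
    #|F| <= 2 * d * d.+1 * (4 * r * d).+1
    & forall w, w \in X -> walk e (Y :\: F) r.+1 v w -> w = v].
Proof.
move=> X0 dgn; have [B [E [L Emax]]] := maximal_linkage.
have [BX Bd BE Bc] := L.
set O := Y :\: core B in Emax.
pose h x y := ((x, y) \in E) || ((y, x) \in E).
have h_sym : symmetric h by move=> x y; rewrite /h orbC.
have hm : minor r Y e X h.
  exists B; split=> // [x /BX[]|x y xX yX xy /orP[] /BE[_ _ _ [u [v [uB vB uv]]]]] //.
    by exists u, v.
  by exists v, u; rewrite e_sym.
have dX := dgn _ _ X0 h_sym hm.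
have [I [IX cI Iind]] := degenerate_independent h_sym dX.
have cE : #|E| <= 2 * d * #|X|.
  apply: leq_trans (degenerate_edges h_sym dX).
  rewrite sum_nb_pairs.
  apply/subset_leq_card/subsetP => -[x y] xyE; have [xX yX _ _] := BE _ _ xyE.
  by rewrite !inE xX yX /h xyE.
have cC : #|core B| <= (4 * r * d).+1 * #|X| by nia.
have XC : X \subset core B.
  by apply/subsetP => x xX; apply: (core_sub L xX); have [] := BX x xX.
have CY : core B \subset Y by apply/bigcupsP => x /BX[].
pose Z v := [set z | walk e O r v z].
pose bd v := [set w in core B :\ v | [exists z in Z v, e z w]].
have ZO v z : z \in Z v -> z = v \/ z \in O.
  by rewrite inE => /walk_mem[->|]; [left|right].
have ZC v z : z \in Z v -> z \in core B -> z = v.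
  by move=> /ZO[//|/setDP[_ /negP]].
have vZ v : v \in Z v by rewrite inE walkxx.
have walkZ v z : z \in Z v -> walk e (Z v) r v z.
  rewrite inE => /walk_trace[Q [QO _ Qvz Qv]]; apply: walk_sub Qvz => //.
  by apply/subsetP => q qQ; rewrite inE; apply: walk_sub (Qv q qQ).
pose g v w := ((v \in I) && (w \in bd v)) || ((w \in I) && (v \in bd w)).
have g_sym : symmetric g by move=> v w; rewrite /g orbC.
(* Members of [I] get their balls, the other core vertices stay singletons. Two balls with a common
   vertex would allow [E] to grow. *)
have gm : minor r Y e (core B) g.
  exists (fun v => if v \in I then Z v else [set v]); split=> //.
  - move=> v vC; case: ifP => vI.
      split=> //; last exact: walkZ.
      apply/subsetP => z /ZO[->|/setDP[]//]; exact: (subsetP CY).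
    rewrite set11 sub1set (subsetP CY) //; split=> // y /set1P->.
    exact: walkxx.
  - move=> v w vC wC vw; apply/pred0P => z /=; apply/negP => /andP[].
    case: ifP => vI; case: ifP => wI zv zw.
    + have vX := subsetP IX v vI; have wX := subsetP IX w wI.
      move: zv zw; rewrite !inE; apply: (Emax v w z) => //.
      by have := Iind v w vI wI vw; rewrite negb_or => /andP[].
    + move: zw vw => /set1P zw; rewrite -(ZC _ _ zv) zw ?eqxx //.
    + move: zv vw => /set1P zv; rewrite -(ZC _ _ zw) zv ?eqxx //.
    + by move: zv zw vw => /set1P-> /set1P->; rewrite eqxx.
  move=> v w vC wC vw /orP[] /andP[vI]; rewrite inE => /andP[_ /exists_inP[z zZ zw]].
  - exists z, w; rewrite vI; split=> //; case: ifP => // _; exact: set11.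
  - exists v, z; rewrite vI; split=> //; last by rewrite e_sym.
    by case: ifP => // _; exact: set11.
have C0 : core B != set0.
  by apply: contraNneq X0 => C0; rewrite -subset0 -C0.
have gd := dgn _ _ C0 g_sym gm.
have gE := degenerate_edges g_sym gd.
set K := 2 * d * _ * _.
(* The degrees in [g] sum to at most [2 * d * #|core B|], and [#|core B| <= (4 * r * d).+1 * d.+1 *
   #|I|], so the average boundary over [I] is at most [K]. *)
have [v vI vK] : exists2 v, v \in I & #|bd v| <= K.
  apply/exists_inP; apply: contraT; rewrite negb_exists_in => /forall_inP big.
  have I0 : 0 < #|I|.
    by case: (posnP #|I|) cI => // ->; rewrite muln0 leqn0 cards_eq0 (negPf X0).
  have lo : #|I| * K.+1 <= \sum_(v in core B) #|nb g (core B) v|.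
    rewrite -sum_nat_const.
    apply: (@leq_trans (\sum_(v in I) #|bd v|)).
      by apply: leq_sum => v /big; rewrite -ltnNge.
    rewrite big_mkcond [leqRHS]big_mkcond; apply: leq_sum => v _.
    case: ifP => // vI; rewrite (subsetP XC) ?(subsetP IX) //.
    apply/subset_leq_card/subsetP => w wb; rewrite inE /g vI wb /= andbT.
    by move: wb; rewrite inE => /andP[/setD1P[]].
  have up : #|I| * K.+1 <= #|I| * K.
    apply: leq_trans lo _; apply: leq_trans gE _.
    apply: (@leq_trans (2 * d * ((4 * r * d).+1 * (d.+1 * #|I|)))).
      rewrite leq_mul2l; apply/orP; right; apply: leq_trans cC _.
      by rewrite leq_mul2l cI orbT.
    by rewrite /K; nia.
  by rewrite leq_pmul2l // ltnn in up.
exists v, (bd v); split=> //; first exact: (subsetP IX).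
  by rewrite !inE eqxx.
move=> w wX.
(* [m] bounds the number of steps outside the core since the last visit to [v]. The ball has radius
   [r] and its boundary is one step further, hence [r.+1]; a return to the core elsewhere than at
   [v] would hit the boundary. *)
suff H n z m : walk e O m v z -> m + n <= r.+1 -> walk e (Y :\: bd v) n z w -> w = v.
  by apply: (H _ _ 0) => //; apply: walkxx.
elim: n z m => [|n IHn] z m vz mn.
  move=> /walk0 zw; case: (walk_mem vz) => [-> //|/setDP[_]].
  by rewrite zw (subsetP XC).
move=> /walkSP[zw|[z1 [/setDP[z1Y z1F] zz1 z1w]]].
  case: (walk_mem vz) => [-> //|/setDP[_]].
  by rewrite zw (subsetP XC).
have mnr : m + n <= r by rewrite addnS ltnS in mn.
have zZ : z \in Z v.
  by rewrite inE; apply: walk_sub vz => //; apply: leq_trans mnr; apply: leq_addr.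
have [z1C|z1C] := boolP (z1 \in core B); last first.
  apply: (IHn z1 m.+1) z1w; last by rewrite addSn.
  rewrite -addn1; apply: (walk_cat vz); apply: walk1 => //.
  by rewrite inE z1C.
have [z1v|z1v] := eqVneq z1 v.
  by apply: (IHn z1 0) z1w; [rewrite z1v walkxx | apply/leqW/(leq_trans _ mnr)/leq_addl].
move: z1F; rewrite inE => /negP[]; rewrite inE z1C in_set1 z1v /=.
by apply/exists_inP; exists z.
Qed.
End Cuts.

(** * Weak reachability along an elimination order *)

Section WeakReachability.
Variables (V : finType) (e : rel V) (Y : {set V}).

Definition wreach (rho : V -> nat) r v :=
  [set w in Y | (rho w <= rho v) && walk e [set u in Y | rho w <= rho u] r v w].

Definition cuts (rho : V -> nat) r v (F : {set V}) :=
  forall w, w \in Y -> rho w <= rho v -> walk e (Y :\: F) r v w -> w = v.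

(** The vertex cut off within [X] is placed last and removed; the vertices placed no later than it
    are then exactly those of [X], to which its cut refers. *)
Lemma elimination_order r K :
  (forall X : {set V}, X \subset Y -> X != set0 ->
     exists v (F : {set V}), [/\ v \in X, #|F| <= K
       & forall w, w \in X -> walk e (Y :\: F) r v w -> w = v]) ->
  exists rho, forall v, v \in Y -> exists2 F : {set V}, #|F| <= K & cuts rho r v F.
Proof.
move=> cut.
suff H m (X : {set V}) : #|X| = m -> X \subset Y -> exists rho, forall v, v \in X ->
    rho v < m /\ exists2 F : {set V}, #|F| <= K &
      forall w, w \in X -> rho w <= rho v -> walk e (Y :\: F) r v w -> w = v.
  have [rho Hrho] := H _ Y erefl (subxx _).
  by exists rho => v /Hrho[].
elim: m X => [|m IHm] X.
  move=> /eqP; rewrite cards_eq0 => /eqP-> _; exists (fun=> 0) => v.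
  by rewrite inE.
move=> cX XY; have X0 : X != set0 by rewrite -card_gt0 cX.
have [v [F [vX FK Fv]]] := cut X XY X0.
have [||rho Hrho] := IHm (X :\ v).
- by move: cX; rewrite (cardsD1 v) vX => -[].
- by apply: subset_trans XY; apply: subD1set.
exists (fun u => if u == v then m else rho u) => u uX.
have [->|uv] := eqVneq u v.
  by split=> //; exists F => // w wX _; apply: Fv.
have [|um [F' F'K F'u]] := Hrho u; first by rewrite !inE uv.
split; first exact: ltnW.
exists F' => // w wX; case: eqVneq => [_|wv]; first by rewrite leqNgt um.
by apply: F'u; rewrite !inE wv.
Qed.

(* A walk from [v] to [w] that stays above [w] meets the cut of [v] in a vertex
   from which the rest of the walk is again of this kind; hence [w] is obtained
   from [v] by passing at most [r] times to an element of the cut. *)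
Lemma wreach_card rho r K :
  (forall v, v \in Y -> exists2 F : {set V}, #|F| <= K & cuts rho r v F) ->
  forall v, v \in Y -> #|wreach rho r v| <= K.+1 ^ r.
Proof.
move=> H.
have /choice[F FP] : forall v, exists F : {set V}, v \in Y -> #|F| <= K /\ cuts rho r v F.
  move=> v; have [vY|_] := boolP (v \in Y); last by exists set0.
  by have [F ? ?] := H v vY; exists F.
pose fix cl (n : nat) (v : V) {struct n} : {set V} :=
  if n is n'.+1 then v |: \bigcup_(f in F v :&: Y) cl n' f else [set v].
have cl_self n v : v \in cl n v by case: n => [|n] /=; rewrite !inE eqxx.
have cl_card n v : v \in Y -> #|cl n v| <= K.+1 ^ n.
  elim: n v => [|n IHn] v vY; first by rewrite cards1.
  have [FK _] := FP v vY; rewrite /= cardsU1 expnS mulSn.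
  apply: leq_add; first by apply: leq_trans (leq_b1 _) _; rewrite expn_gt0.
  have le : #|F v :&: Y| <= K by apply: leq_trans FK; apply/subset_leq_card/subsetIl.
  apply: leq_trans (leq_card_bigcup _ _) _.
  apply: (@leq_trans (\sum_(f in F v :&: Y) K.+1 ^ n)).
    by apply: leq_sum => f /setIP[_ fY]; apply: IHn.
  by rewrite sum_nat_const leq_mul2r le orbT.
move=> v vY; apply: leq_trans (cl_card r v vY); apply/subset_leq_card/subsetP => w.
rewrite inE => /and3P[wY wv].
set Yw := [set u in Y | _].
suff Hn n : n <= r -> forall u, u \in Y -> rho w <= rho u ->
    walk e Yw n u w -> w \in cl n u.
  exact: Hn.
elim: n => [|n IHn] nr u uY wu; first by move=> /walk0->; apply: cl_self.
move=> uw; have [<-|nwu] := eqVneq w u; first exact: cl_self.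
have [_ Fcut] := FP u uY.
have [|f [fF fYw fw]] := @walk_avoid _ _ _ (F u) _ _ _ uw.
  apply: contra nwu => uw'; apply/eqP; apply: Fcut => //.
  by apply: walk_sub uw' => //; apply: setSD; apply/subsetP => x; rewrite inE => /andP[].
have [fY wf] : f \in Y /\ rho w <= rho f by move: fYw; rewrite inE => /andP[].
apply/setUP; right; apply/bigcupP; exists f; first by rewrite inE fF.
by apply: IHn => //; apply: ltnW.
Qed.

Lemma wreach_sub rho r r' v : r <= r' -> wreach rho r v \subset wreach rho r' v.
Proof.
move=> rr'; apply/subsetP => w; rewrite !inE => /and3P[-> -> /=].
exact: walk_sub.
Qed.

(** Reverse the walk from [v] to [m'] and append the walk from [v] to [m]; both stay above [m], the
    former because [rho m <= rho m']. *)
Lemma wreach_wreach rho r s v m m' : symmetric e -> v \in Y ->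
  m \in wreach rho r v -> m' \in wreach rho s v -> rho m <= rho m' ->
  m \in wreach rho (s + r) m'.
Proof.
move=> e_sym vY; rewrite !inE => /and3P[mY mv vm] /and3P[m'Y m'v vm'] mm'.
rewrite mY mm' /=; apply: walk_cat vm; apply: walk_rev => //.
  by rewrite inE vY.
apply: walk_sub vm' => //; apply/subsetP => u; rewrite !inE => /andP[-> /=].
exact: leq_trans.
Qed.

(** A vertex [m] of the path with least [rho] splits it into two parts that both stay above [m]. *)
Lemma path_wreach rho d x p : symmetric e ->
  path e x p -> {subset x :: p <= Y} -> size p <= d ->
  exists m, [/\ m \in x :: p, m \in wreach rho d x & m \in wreach rho d (last x p)].
Proof.
move=> e_sym xp pY pd.
have xin : x \in x :: p by rewrite inE eqxx.
have [m mp mmin] := @arg_minnP _ x (mem (x :: p)) rho xin.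
have mY : m \in Y by apply: pY.
exists m; split=> //.
  rewrite inE mY mmin //=.
  case/splitPl: mp xp pY pd mmin => p1 p2 <-.
  rewrite cat_path => /andP[xp1 _] pY pd mmin.
  apply: walk_sub (walk_path xp1 _) => //.
    by apply: leq_trans pd; rewrite size_cat leq_addr.
  move=> u up1; have up : u \in x :: p1 ++ p2 by rewrite inE mem_cat up1 orbT.
  by rewrite inE pY //=; apply: mmin.
have lin : last x p \in x :: p by apply: mem_last.
rewrite inE mY mmin //=.
case/splitPl: mp xp pY pd mmin => p1 p2 pm.
rewrite cat_path last_cat pm => /andP[_ xp2] pY pd mmin.
apply: walk_rev => //; first by rewrite inE mY leqnn.
apply: walk_sub (walk_path xp2 _) => //.
  by apply: leq_trans pd; rewrite size_cat leq_addl.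
move=> u up2; have up : u \in x :: p1 ++ p2 by rewrite inE mem_cat up2 !orbT.
by rewrite inE pY //=; apply: mmin.
Qed.

End WeakReachability.

Lemma sparse_wreach T r p : exists C, forall (V : finType) (Y : {set V}) e,
  symmetric e -> sparse T Y e -> Y != set0 ->
  exists rho w, w ^ p <= C * #|Y| /\
    forall v, v \in Y -> #|wreach e Y rho r v| <= w.
Proof.
(* The cut size [K] is cubic in the degeneracy [d], so [w ^ p] with [w = K.+1 ^ r] is of order
   [d ^ (3 * (r * p))]. *)
pose j := 3 * (r * p).
have [C HC] := sparse_degenerate j (fun s => T (s * (2 * r + 1) + r)).
exists ((16 * r + 5) ^ (r * p) * C.+1) => V Y e e_sym Ys Y0.
have Y_gt0 : 0 < #|Y| by rewrite card_gt0.
(* [C.+1] instead of [C] makes the largest such [d] positive, so that the lower-order terms of [K]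
   are absorbed by [d ^ 3]. *)
have ex0 : exists d, d ^ j.+1 <= C.+1 * #|Y| by exists 0; rewrite exp0n.
have bd d : d ^ j.+1 <= C.+1 * #|Y| -> d <= C.+1 * #|Y|.
  exact/leq_trans/leq_expn_self.
have [d dC dmax] := ex_maxnP ex0 bd.
have d_gt0 : 0 < d by apply: dmax; rewrite exp1n muln_gt0.
have dgn X' e' : X' != set0 -> symmetric e' -> minor r Y e X' e' -> degenerate d X' e'.
  move=> X'0 e'_sym m; have [B [X'Y _ _ _]] := m.
  have [d' d'C d'X'] := HC V X' e' e'_sym (sparse_minor e_sym Ys m) X'0.
  have d'd : d' <= d.
    apply: dmax; apply: leq_trans d'C _; apply: leq_mul => //.
    exact: subset_leq_card.
  move=> X'' X''X' X''0; have [x xX'' dx] := d'X' X'' X''X' X''0.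
  by exists x => //; apply: leq_trans d'd.
pose K := 2 * d * d.+1 * (4 * r * d).+1.
have [|rho Hrho] := @elimination_order V e Y r K.
  move=> X XY X0.
  have [v [F [vX _ FK Fv]]] := small_cut e_sym XY X0 dgn.
  exists v, F; split=> // w wX vw; apply: Fv => //.
  exact: walk_sub vw.
exists rho, (K.+1 ^ r); split; last exact: wreach_card.
have Kd : K.+1 <= (16 * r + 5) * d ^ 3.
  rewrite /K; move: d_gt0; clear; case: d => // d _; nia.
rewrite -expnM; apply: (@leq_trans (((16 * r + 5) * d ^ 3) ^ (r * p))).
  exact: leq_expn2r.
rewrite expnMn -mulnA leq_mul2l; apply/orP; right.
rewrite -expnM; apply: leq_trans dC; rewrite leq_pexp2l //.
Qed.

(** * Kernels *)

(** An empty member is a kernel by itself, and so are [k.+1] disjoint members, which no [k] vertices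
    can hit. Otherwise a maximal disjoint subfamily covers few vertices and every member contains
    one of them; recurse, for each such vertex [u], on the members through [u] with [u] deleted. *)
Lemma hitting_kernel (V : finType) (F : {set {set V}}) s k :
  (forall f, f \in F -> #|f| <= s) ->
  exists F' : {set {set V}}, [/\ F' \subset F, #|F'| <= (k.+1 * s.+1) ^ s
    & forall S : {set V}, #|S| <= k ->
        (forall f, f \in F' -> f :&: S != set0) ->
        forall f, f \in F -> f :&: S != set0].
Proof.
elim: s F => [|s IHs] F Fs.
  exists F; split=> //; apply: (@leq_trans #|[set set0 : {set V}]|).
    apply/subset_leq_card/subsetP => f /Fs.
    by rewrite leqn0 cards_eq0 inE.
  by rewrite cards1.
have pos : 0 < (k.+1 * s.+2) ^ s.+1 by rewrite expn_gt0.
have [F0|F0] := boolP (set0 \in F).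
  exists [set set0]; split; rewrite ?sub1set ?cards1 // => S _ /(_ set0).
  by rewrite inE eqxx set0I eqxx => /(_ isT).
pose P (D : {set {set V}}) := trivIset D && (D \subset F).
have [|D /maxsetP[/andP[Dtriv DF] Dmax] _] := @maxset_exists _ P set0.
  by rewrite /P sub0set andbT; apply/trivIsetP => A B; rewrite inE.
have D0 : set0 \notin D by apply: contra F0; apply: (subsetP DF).
have [kD|Dk] := ltnP k #|D|.
  have [D' D'D cD'] : exists2 D' : {set {set V}}, D' \subset D & #|D'| = k.+1.
    have : 0 < #|[set B : {set {set V}} | B \subset D & #|B| == k.+1]|.
      by rewrite cards_draws bin_gt0.
    by move=> /card_gt0P[D']; rewrite inE => /andP[? /eqP ?]; exists D'.
  exists D'; split.
  - exact: subset_trans DF.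
  - rewrite cD'; apply: (@leq_trans (k.+1 * s.+2)); first by rewrite leq_pmulr.
    by rewrite expnS leq_pmulr // expn_gt0.
  move=> S Sk hit; suff : k < #|S| by rewrite ltnNge Sk.
  rewrite -cD' -sum1_card; apply: (@leq_trans (\sum_(f in D') #|[set z in S | z \in f]|)).
    apply: leq_sum => f /hit/set0Pn[z]; rewrite inE => /andP[zf zS].
    by apply/card_gt0P; exists z; rewrite inE zS.
  rewrite sum_card_rel -sum1_card; apply: leq_sum => z _.
  apply/card_le1_eqP => f g; rewrite !inE => /andP[fD' zf] /andP[gD' zg].
  apply/eqP; apply: contraT; rewrite eq_sym => fg.
  have /trivIsetP/(_ f g (subsetP D'D f fD') (subsetP D'D g gD') fg) := Dtriv.
  by rewrite disjoint_subset => /subsetP/(_ z zf); rewrite inE zg.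
pose U := cover D.
pose Fu u := [set f :\ u | f in [set f in F | u \in f]].
have /choice[K KP] : forall u, exists Ku : {set {set V}}, [/\ Ku \subset Fu u,
    #|Ku| <= (k.+1 * s.+1) ^ s & forall S : {set V}, #|S| <= k ->
        (forall f, f \in Ku -> f :&: S != set0) ->
        forall f, f \in Fu u -> f :&: S != set0].
  move=> u; apply: IHs => _ /imsetP[f + ->]; rewrite inE => /andP[fF uf].
  by have := Fs f fF; rewrite (cardsD1 u) uf.
exists (\bigcup_(u in U) [set u |: f | f in K u]); split.
- apply/bigcupsP => u _; apply/subsetP => _ /imsetP[f fK ->].
  have [/subsetP/(_ f fK)/imsetP[f0 + ->] _ _] := KP u.
  by rewrite inE => /andP[f0F uf0]; rewrite setD1K.
- have cU : #|U| <= k * s.+1.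
    rewrite /U; have /eqP <- : trivIset D by [].
    apply: (@leq_trans (\sum_(f in D) s.+1)).
      by apply: leq_sum => f /(subsetP DF)/Fs.
    by rewrite sum_nat_const leq_mul2r Dk.
  apply: leq_trans (leq_card_bigcup _ _) _.
  apply: (@leq_trans (\sum_(u in U) (k.+1 * s.+1) ^ s)).
    apply: leq_sum => u _; apply: leq_trans (leq_imset_card _ _) _.
    by have [] := KP u.
  rewrite sum_nat_const expnS; apply: leq_mul.
    by apply: leq_trans cU _; apply: leq_mul.
  by apply: leq_expn2r; rewrite leq_mul2l leqnSn orbT.
move=> S Sk hit f fF.
have [u uU uf] : exists2 u, u \in U & u \in f.
  apply/exists_inP; apply: contraT; rewrite negb_exists_in => /forall_inP fU.
  have fD g : g \in D -> [disjoint f & g].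
    move=> gD; rewrite disjoint_sym disjoint_subset; apply/subsetP => u ug.
    by apply: fU; apply/bigcupP; exists g.
  have [fDt fnD] := trivIsetU1 fD Dtriv D0.
  have : f |: D = D.
    apply: Dmax; last exact: subsetUr.
    by rewrite /P fDt subUset sub1set fF DF.
  by move=> E; rewrite -E setU11 in fnD.
have [uS|uS] := boolP (u \in S).
  by apply/set0Pn; exists u; rewrite inE uf.
have [_ _ KS] := KP u.
have : (f :\ u) :&: S != set0.
  apply: KS => //; last by apply/imsetP; exists f; rewrite ?inE ?fF.
  move=> f' f'K; have /set0Pn[z] : (u |: f') :&: S != set0.
    by apply: hit; apply/bigcupP; exists u => //; apply: imset_f.
  rewrite !inE => /andP[/orP[/eqP->|zf'] zS]; first by rewrite zS in uS.
  by apply/set0Pn; exists z; rewrite inE zf'.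
move=> /set0Pn[z]; rewrite !inE => /andP[/andP[_ zf] zS].
by apply/set0Pn; exists z; rewrite inE zf.
Qed.

(** Read [b] as gain and [d] as damage. Bins whose damage times [M] lies between [a] and [2 * a] are
    split off until the rest is itself a bin. Each split uses up [a] of the total [N * a], so one of
    at most [N.+1] bins has the required gain. *)
Lemma heavy_bin (T : finType) (I : {set T}) (b d : T -> nat) a M N :
  (forall i, i \in I -> d i * M <= a) -> (\sum_(i in I) d i) * M <= N * a ->
  exists J : {set T}, [/\ J \subset I, (\sum_(i in J) d i) * M <= 2 * a
    & \sum_(i in I) b i <= N.+1 * \sum_(i in J) b i].
Proof.
elim: N I => [|N IHN] I Id Isum.
  by exists I; split; [|lia|rewrite mul1n].
have [small|big] := leqP ((\sum_(i in I) d i) * M) (2 * a).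
  by exists I; split=> //; apply: leq_pmull.
pose P (J : {set T}) := (J \subset I) && (a <= (\sum_(i in J) d i) * M).
have PI : P I by rewrite /P subxx /=; lia.
have [J /andP[JI aJ] Jmin] := @arg_minnP _ I P (fun J => #|J|) PI.
have J2a : (\sum_(i in J) d i) * M <= 2 * a.
  have [J0|[i iJ]] := set_0Vmem J.
    by move: aJ; rewrite J0 big_set0; lia.
  have : ~~ P (J :\ i).
    by apply/negP => /Jmin; rewrite [#|J|](cardsD1 i) iJ add1n ltnn.
  rewrite /P (subset_trans (subsetDl _ _) JI) -ltnNge /= (big_setD1 i iJ) /= => lt.
  by rewrite mulnDl mul2n -addnn leq_add ?Id ?(subsetP JI) // ltnW.
have [JN|JN] := leqP (\sum_(i in I) b i) (N.+2 * \sum_(i in J) b i).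
  by exists J.
have splitI (f : T -> nat) :
    \sum_(i in I) f i = \sum_(i in J) f i + \sum_(i in I :\: J) f i.
  by rewrite (big_setID J) /= (setIidPr JI).
have [||J' [J'I J'a J'b]] := IHN (I :\: J).
- by move=> i /setDP[/Id].
- by move: Isum; rewrite splitI; lia.
exists J'; split=> //; first exact: subset_trans J'I (subsetDl _ _).
move: J'b JN; rewrite splitI.
move: (\sum_(i in J) b i) (\sum_(i in I :\: J) b i) (\sum_(i in J') b i).
move=> x y z yz xy; rewrite -(leq_pmul2l (ltn0Sn N)).
have : N.+2 * y <= N.+2 * (N.+1 * z) by rewrite leq_mul2l yz orbT.
rewrite mulnCA; lia.
Qed.

(** * Selecting B' *)

Section Selection.
(* [W1] and [W2] stand for weak d- and 2d-reachability along [rho]; the elements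
   of [W1 v] are the hubs of [v]. *)
Variables (V : finType) (Y A B : {set V}) (W1 W2 : V -> {set V}) (rho : V -> nat).
Variables (w s lam M : nat).
Hypotheses (w_gt0 : 0 < w)
  (W1Y : forall v, v \in A :|: B -> W1 v \subset Y)
  (W1w : forall v, v \in A :|: B -> #|W1 v| <= w)
  (W2w : forall y, y \in Y -> #|W2 y| <= w)
  (W12 : forall b m m', b \in B -> m \in W1 b -> m' \in W1 b ->
     rho m <= rho m' -> m \in W2 m')
  (Ys : #|Y| < lam ^ s).

Let above (X : {set V}) m := [set y in X | m \in W2 y].

Fixpoint layer i : {set V} :=
  if i is i'.+1 then [set m in layer i' | w * lam < #|above (layer i') m|] else Y.

Lemma layer_sub i j : i <= j -> layer j \subset layer i.
Proof.
elim: j => [|j IHj]; first by rewrite leqn0 => /eqP->.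
rewrite leq_eqVlt => /orP[/eqP-> //|/IHj]; apply: subset_trans.
by apply/subsetP => m; rewrite inE => /andP[].
Qed.

(** Double counting: each [m] in the next layer lies in more than [w * lam] of the sets [W2 y],
    which have at most [w] elements each, so every layer shrinks by a factor [lam]. *)
Lemma layer_card i : #|layer i| * lam ^ i <= #|Y|.
Proof.
elim: i => [|i IHi]; first by rewrite muln1.
apply: leq_trans IHi; rewrite expnS mulnA leq_mul2r; apply/orP; right.
rewrite -(leq_pmul2l w_gt0) mulnCA.
apply: (@leq_trans (\sum_(m in layer i.+1) #|above (layer i) m|)).
  rewrite -sum_nat_const; apply: leq_sum => m.
  by rewrite inE => /andP[_ /ltnW].
rewrite sum_card_rel mulnC -sum_nat_const; apply: leq_sum => y yX.
apply: leq_trans (W2w (subsetP (layer_sub (leq0n i)) y yX)).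
by apply/subset_leq_card/subsetP => m; rewrite inE => /andP[].
Qed.

Lemma layer_end : layer s = set0.
Proof.
apply/eqP; rewrite -cards_eq0; case: posnP => // X0.
have := leq_trans (leq_pmull _ X0) (layer_card s).
by rewrite leqNgt Ys.
Qed.

Definition top i b x := x \in W1 b :&: layer i /\
  forall m, m \in W1 b :&: layer i -> rho m <= rho x.

Lemma top_exists i b m : m \in W1 b :&: layer i -> exists x, top i b x.
Proof.
move=> mW; have [x xW xmax] := @arg_maxnP _ m (mem (W1 b :&: layer i)) rho mW.
by exists x.
Qed.

(* The vertices of [A] that share a hub of level at most [i] with some vertex of
   [B] whose top hub in [layer i] is [x]. *)
Definition damage i x := [set a in A | [exists b in B,
  `[< top i b x >] && [exists m in W1 a :&: W1 b, m \notin layer i.+1]]].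

Lemma level_exists m : m \in Y -> exists j, m \in layer j /\ m \notin layer j.+1.
Proof.
move=> mY; have ex : exists j, m \notin layer j by exists s; rewrite layer_end inE.
have [[|j] mj jmin] := ex_minnP ex; first by rewrite mY in mj.
exists j; split=> //; apply: contraT => /jmin.
by rewrite ltnn.
Qed.

(* Such a hub [m], of level [j <= i], lies in [W2 y] for the top hub [y] of [b]
   in [layer j]; there are few such [y] since [m] is not in [layer j.+1], and
   [x] lies in [W2 y]. *)
Lemma damage_sum i : \sum_(x in layer i) #|damage i x| <= #|A| * (w * (w * lam) * w).
Proof.
rewrite sum_card_rel -sum_nat_const; apply: leq_sum => a aA.
have /choice[lev levP] : forall m, exists j, m \in Y ->
    m \in layer j /\ m \notin layer j.+1.
  move=> m; have [mY|_] := boolP (m \in Y); last by exists 0.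
  by have [j] := level_exists mY; exists j.
pose up m := above (layer (lev m)) m.
have aAB : a \in A :|: B by rewrite inE aA.
apply: (@leq_trans #|\bigcup_(m in W1 a) \bigcup_(y in up m) W2 y|).
  apply/subset_leq_card/subsetP => x; rewrite inE => /andP[xi].
  move=> /exists_inP[b bB /andP[/asboolP[xW xmax]]].
  move=> /exists_inP[m /setIP[ma mb] mi].
  have mY : m \in Y by apply: (subsetP (W1Y aAB)).
  have [mj mj1] := levP m mY.
  have ji : lev m <= i.
    rewrite leqNgt; apply: contra mi => ij; exact: (subsetP (layer_sub ij)).
  have [y [/setIP[yb yj] ymax]] : exists y, top (lev m) b y.
    by apply: (@top_exists _ _ m); rewrite inE mb.
  have [xb _] := setIP xW.
  apply/bigcupP; exists m => //; apply/bigcupP; exists y.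
    by rewrite inE yj; apply: (W12 bB mb yb); apply: ymax; rewrite inE mb.
  apply: (W12 bB xb yb); apply: ymax; rewrite inE xb.
  exact: (subsetP (layer_sub ji)).
apply: leq_trans (leq_card_bigcup _ _) _.
apply: (@leq_trans (\sum_(m in W1 a) (w * lam * w))); last first.
  by rewrite sum_nat_const -[leqRHS]mulnA leq_mul2r (W1w aAB) orbT.
apply: leq_sum => m ma.
have mY : m \in Y by apply: (subsetP (W1Y aAB)).
have [mj mj1] := levP m mY.
apply: leq_trans (leq_card_bigcup _ _) _.
apply: (@leq_trans (\sum_(y in up m) w)).
  apply: leq_sum => y; rewrite inE => /andP[yj _]; apply: W2w.
  exact: (subsetP (layer_sub (leq0n _))) yj.
rewrite sum_nat_const leq_mul2r; apply/orP; right.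
by move: mj1; rewrite inE mj -leqNgt.
Qed.

Let P := w * (w * lam) * w.
Let bad i := [set x in layer i | #|A| < #|damage i x| * M].
Let S := \bigcup_(i < s) \bigcup_(x in bad i) W2 x.

(** Markov's inequality applied to [damage_sum]. *)
Lemma bad_card i : 0 < #|A| -> #|bad i| <= P * M.
Proof.
move=> A0; rewrite -(leq_pmul2l A0).
apply: (@leq_trans (\sum_(x in bad i) #|damage i x| * M)).
  rewrite mulnC -sum_nat_const; apply: leq_sum => x.
  by rewrite inE => /andP[_ /ltnW].
rewrite -big_distrl /= mulnA leq_mul2r; apply/orP; right.
apply: leq_trans (damage_sum i).
rewrite [leqRHS](big_setID (bad i)) /=.
have badX : bad i \subset layer i by apply/subsetP => x; rewrite inE => /andP[].
by rewrite (setIidPr badX) leq_addr.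
Qed.

Lemma separator_card : 0 < #|A| -> #|S| <= s * (P * M * w).
Proof.
move=> A0; apply: (@leq_trans (\sum_(i < s) #|\bigcup_(x in bad i) W2 x|)).
  apply: (big_ind2 (fun (U : {set V}) n => #|U| <= n)) => [|U m U' n Um U'n|//].
    by rewrite cards0.
  by apply: leq_trans (leq_card_setU _ _) _; apply: leq_add.
rewrite -[s in leqRHS]card_ord -sum_nat_const; apply: leq_sum => i _.
apply: leq_trans (leq_card_bigcup _ _) _.
apply: (@leq_trans (\sum_(x in bad i) w)).
  apply: leq_sum => x; rewrite inE => /andP[xi _]; apply: W2w.
  exact: (subsetP (layer_sub (leq0n _))) xi.
by rewrite sum_nat_const leq_mul2r bad_card ?orbT.
Qed.

(** Take the least layer whose hubs of [b] all lie in [S]. If it is not layer 0, the top hub [x] of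
    [b] in the preceding layer is not bad: otherwise [W2 x], which contains all hubs of [b] in that
    layer, would be part of [S]. *)
Lemma good_class b : b \in B -> W1 b \subset S \/
  exists (i : 'I_s) x, [/\ x \in layer i, top i b x, #|damage i x| * M <= #|A|
    & W1 b :&: layer i.+1 \subset S].
Proof.
move=> bB.
have ex : exists i, W1 b :&: layer i \subset S.
  by exists s; rewrite layer_end setI0 sub0set.
have [[|i] iS imin] := ex_minnP ex.
  have /setIidPl E : W1 b \subset Y by apply: W1Y; rewrite inE bB orbT.
  by left; rewrite -E.
right; have niS : ~~ (W1 b :&: layer i \subset S).
  by apply/negP => /imin; rewrite ltnn.
have i_lt : i < s.
  by apply: imin; rewrite layer_end setI0 sub0set.
have [m mW mS] := subsetPn niS.
have [x xtop] := top_exists mW; have [/setIP[xb xi] xmax] := xtop.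
exists (Ordinal i_lt), x; split=> //.
rewrite leqNgt; apply: contra mS => xbad.
apply/bigcupP; exists (Ordinal i_lt) => //; apply/bigcupP; exists x.
  by rewrite inE xi.
by have [mb _] := setIP mW; apply: (W12 bB mb xb); apply: xmax.
Qed.

Lemma select_classes : exists S A' B' : {set V},
  [/\ A' \subset A, B' \subset B, #|A :\: A'| * M <= 2 * #|A|,
      #|B| <= (s * (P * M)).+1 * #|B'| & #|S| <= s * (P * M * w)] /\
  forall a b m, a \in A' -> b \in B' -> m \in W1 a -> m \in W1 b -> m \in S.
Proof.
have [A0|A_gt0] := posnP #|A|.
  exists set0, set0, B; split; last by move=> a b m; rewrite inE.
  by rewrite sub0set subxx setD0 A0 cards0; split=> //; rewrite leq_pmull.
(* [None] labels the vertices whose hubs all lie in [S]; this class does no damage. *)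
have /choice[c cP] : forall b, exists c : option ('I_s * V), b \in B ->
    if c is Some (i, x) then [/\ x \in layer i, top i b x,
      #|damage i x| * M <= #|A| & W1 b :&: layer i.+1 \subset S]
    else W1 b \subset S.
  move=> b; have [bB|_] := boolP (b \in B); last by exists None.
  by have [bS|[i [x H]]] := good_class bB; [exists None|exists (Some (i, x))].
pose D (t : option ('I_s * V)) := if t is Some (i, x) then damage i x else set0.
pose I := [set t : option ('I_s * V) | if t is Some (i, x) then
  (x \in layer i) && (#|damage i x| * M <= #|A|) else true].
have Isum : (\sum_(t in I) #|D t|) * M <= s * (P * M) * #|A|.
  have -> : s * (P * M) * #|A| = (s * (#|A| * P)) * M by lia.
  rewrite leq_mul2r; apply/orP; right.
  apply: (@leq_trans (\sum_(i < s) \sum_(x in layer i) #|damage i x|)); last first.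
    have -> : s * (#|A| * P) = \sum_(i < s) #|A| * P by rewrite sum_nat_const card_ord.
    by apply: leq_sum => i _; apply: damage_sum.
  pose Q := [set p : 'I_s * V | p.2 \in layer p.1].
  apply: (@leq_trans (\sum_(t in [set Some p | p in Q]) #|D t|)); last first.
    rewrite big_imset /=; last by move=> p q _ _ [].
    rewrite pair_big_dep /= eq_leq //; apply: eq_big => [p|[i x] _] //.
    by rewrite inE.
  rewrite big_mkcond [leqRHS]big_mkcond; apply: leq_sum => -[p|] _; last first.
    by rewrite cards0; case: ifP.
  case: ifP => //; rewrite inE; case: p => [i x] /andP[xi _].
  by rewrite imset_f // inE.
have Id t : t \in I -> #|D t| * M <= #|A|.
  by rewrite inE; case: t => [[i x] /andP[]|] //=; rewrite cards0.
have [J [JI JD JB]] := heavy_bin (fun t => #|[set b in B | c b == t]|) Id Isum.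
exists S, (A :\: \bigcup_(t in J) D t), [set b in B | c b \in J].
have Bsum (K : {set option ('I_s * V)}) :
    \sum_(t in K) #|[set b in B | c b == t]| = #|[set b in B | c b \in K]|.
  rewrite -sum_card_rel -sum1_card big_mkcond [RHS]big_mkcond /=.
  apply: eq_bigr => b _; rewrite inE; case: (b \in B) => //=.
  rewrite (_ : [set _ in K | _] = if c b \in K then [set c b] else set0).
    by case: ifP; rewrite ?cards1 ?cards0.
  apply/setP => t; rewrite !inE; case: ifP => cb; rewrite inE.
    by rewrite eq_sym; case: eqVneq => [->|]; rewrite ?cb ?andbF.
  by case: eqVneq => [<-|]; rewrite ?cb ?andbF.
split; last first.
  move=> a b m /setDP[aA aD]; rewrite inE => /andP[bB cbJ] ma mb.
  have := cP b bB; case cb: (c b) cbJ => [[i x]|] cbJ; last first.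
    by move/subsetP; apply.
  (* A common hub in [layer i.+1] lies in [S]; any other one would put [a] into [damage i x], which
     was removed from [A]. *)
  case=> xi xtop _ /subsetP iS; apply: contraNT aD => mS.
  apply/bigcupP; exists (Some (i, x)) => //.
  rewrite inE aA; apply/exists_inP; exists b => //.
  apply/andP; split; first exact/asboolP.
  apply/exists_inP; exists m; first by rewrite inE ma.
  by apply: contra mS => mi; apply: iS; rewrite inE mb.
split; [exact: subsetDl| | | |exact: separator_card].
- by apply/subsetP => b; rewrite inE => /andP[].
- apply: leq_trans JD; rewrite leq_mul2r; apply/orP; right.
  apply: leq_trans (leq_card_bigcup _ _); apply/subset_leq_card/subsetP => a.
  by rewrite !inE => /andP[]; rewrite negb_and negbK => /orP[//|/negP].
move: JB; rewrite !Bsum; congr (_ <= _); apply: eq_card => b; rewrite !inE.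
case bB: (b \in B) => //=; have := cP b bB.
by case: (c b) => [[i x] [-> _ -> _]|].
Qed.

End Selection.

(** * Nowhere dense classes *)

(** Also valid for [i >= N], since the default value of [find] is [N]; a witness thus bounds [gdist]
    or [gradius] without a range check. *)
Lemma find_iota_leq (P : pred nat) N i : P i -> find P (iota 0 N) <= i.
Proof.
move=> Pi; rewrite leqNgt; apply/negP => iP.
have iN : i < N by rewrite -(size_iota 0 N); apply: leq_trans iP (find_size _ _).
by have := before_find 0 iP; rewrite nth_iota // add0n Pi.
Qed.

Lemma gdist_leq (G : sgraph) (x y : G) p :
  path (@adj G) x p -> last x p = y -> gdist x y <= size p.
Proof.
move=> xp; case/shortenP: xp => p' xp' up' sub lp'.
apply: (@leq_trans (size p')); last by apply: uniq_leq_size => //; case/andP: up'.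
apply: find_iota_leq; apply/existsP; exists (in_tuple p').
by rewrite /gpath xp' up' lp' /=.
Qed.

Lemma induced_ball (G : sgraph) (X : {set G}) (c : G) r : c \in X ->
  (forall y, y \in X -> walk (@adj G) X r c y) ->
  gconnected (induced X) /\ gradius (induced X) <= r.
Proof.
move=> cX Xc.
have lift n (x y : induced X) : walk (@adj G) X n (val x) (val y) ->
    exists p, [/\ path (@adj (induced X)) x p, last x p = y & size p <= n].
  elim: n x => [|n IHn] x; first by move=> /walk0/val_inj->; exists [::].
  move=> /walkSP[/val_inj->|[z [zX xz zy]]]; first by exists [::].
  have [p [zp py pn]] := IHn (exist _ z zX) zy.
  by exists (exist _ z zX :: p); split=> //=; rewrite zp andbT.
pose c' : induced X := exist _ c cX.
have H (y : induced X) := lift r c' y (Xc _ (valP y)).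
have csym := sym_connect_sym (@adj_sym (induced X)).
split.
  have cc (y : induced X) : connect (@adj (induced X)) c' y.
    by have [p [c'p py _]] := H y; apply/connectP; exists p.
  by move=> x y; apply: connect_trans (cc y); rewrite csym.
apply: find_iota_leq; apply/existsP; exists c'; apply/forallP => y.
by have [p [c'p py pr]] := H y; apply: leq_trans pr; apply: gdist_leq.
Qed.

Lemma minor_depth_minor (H G : sgraph) (K : {set G}) r : #|H| <= #|K| ->
  minor r [set: G] (@adj G) K (fun _ _ => true) -> depth_minor r H G.
Proof.
move=> HK [B [_ BX Bd Be]].
(* Vertices in no branch set are labelled by themselves and become singleton parts. *)
pose lab v := odflt v [pick x in K | v \in B x].
have labP v x : x \in K -> v \in B x -> lab v = x.
  move=> xK vx; rewrite /lab; case: pickP => [y /andP[yK vy]|/(_ x)]; last first.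
    by rewrite xK vx.
  apply/eqP; apply: contraT => /(Bd _ _ yK xK).
  by rewrite disjoint_subset => /subsetP/(_ v vy); rewrite inE vx.
have labK v x : x \in K -> lab v = x -> v \in B x.
  move=> xK; rewrite /lab; case: pickP => [y /andP[yK vy] /= <-//|_ /= ->].
  by have [] := BX x xK.
pose P := preim_partition lab [set: G].
have BP x : x \in K -> B x \in P.
  move=> xK; apply/imsetP; exists x => //.
  apply/setP => v; rewrite !inE /= (labP x x) //; last by have [] := BX x xK.
  by apply/idP/eqP => [/(labP _ _ xK)->//|/esym]; apply: labK.
exists P; split; first exact: preim_partitionP.
  move=> X /imsetP[v _ ->].
  have [x /andP[xK vx]|noK] := pickP (fun x => (x \in K) && (v \in B x)).
    rewrite (_ : [set _ in _ | _] = B x).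
      by have [xB _ Br] := BX x xK; apply: induced_ball xB _.
    apply/setP => u; rewrite !inE /= (labP v x) //.
    by apply/eqP/idP => [/esym|/(labP _ _ xK)->//]; apply: labK.
  rewrite (_ : [set _ in _ | _] = [set v]).
    apply: (@induced_ball _ _ v); first exact: set11.
    by move=> u /set1P->; apply: walkxx.
  have labv : lab v = v by rewrite /lab; case: pickP => // y; rewrite noK.
  apply/setP => u; rewrite !inE /= labv.
  apply/eqP/eqP => [|->]; last by rewrite labv.
  rewrite /lab; case: pickP => //= y /andP[yK uy] vy.
  by have := noK y; rewrite yK vy; have [-> _ _] := BX y yK.
pose g (h : H) := enum_val (widen_ord HK (enum_rank h)).
have gK h : g h \in K by apply: enum_valP.
have g_inj : injective g.
  move=> h h' /enum_val_inj/(congr1 val)/= E.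
  by apply: enum_rank_inj; apply: val_inj.
have BK x y : x \in K -> y \in K -> B x = B y -> x = y.
  move=> xK yK E; have [xB _ _] := BX x xK.
  by rewrite -(labP x x) // (labP x y) // -E.
exists (fun h => exist _ (B (g h)) (BP _ (gK h)) : quotient_graph P).
  by move=> h h' /(congr1 val)/= /(BK _ _ (gK h) (gK h'))/g_inj.
move=> h h' hh'.
have nhh' : g h != g h'.
  by apply: contraTneq hh' => /g_inj->; rewrite adj_irrefl.
apply/andP; split.
  by apply: contra nhh' => /eqP/(congr1 val)/= /(BK _ _ (gK h) (gK h'))->.
have [u [v [uB vB uv]]] := Be _ _ (gK h) (gK h') nhh' isT.
by apply/existsP; exists u; apply/existsP; exists v; apply/and3P.
Qed.

Lemma nowhere_dense_sparse (C : sgraph -> Prop) : nowhere_dense C ->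
  exists T, forall G, C G -> sparse T [set: G] (@adj G).
Proof.
move=> /choice[H HP]; exists (fun r => #|H r|) => G CG r K HK /(minor_depth_minor HK).
exact: HP.
Qed.

(** * Reduction to a subgraph of polynomial size *)

Section PathKernel.
Variables (G : sgraph) (d k : nat).

Definition path_sets (x y : G) := [set f : {set G} |
  [exists n : 'I_d.+1, exists p : n.-tuple G, gpath x y p && (f == [set z in x :: p])]].

Lemma path_setsP x y f :
  reflect (exists2 p, gpath x y p /\ size p <= d & f = [set z in x :: p])
    (f \in path_sets x y).
Proof.
rewrite inE; apply: (iffP existsP) => [[n /existsP[p /andP[xp /eqP->]]]|[p [xp pd] ->]].
  by exists p => //; rewrite size_tuple -ltnS.
exists (Ordinal (pd : size p < d.+1)); apply/existsP; exists (in_tuple p).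
by rewrite /= xp eqxx.
Qed.

(* Small separators of the paths inside [Y] separate in the whole graph, so
   all bounds may be expressed in terms of [#|X|] instead of [#|G|]. *)
Lemma path_kernel (X : {set G}) : exists Y : {set G}, [/\ X \subset Y,
    #|Y| <= #|X| + #|X| * (#|X| * ((k.+1 * d.+2) ^ d.+1 * d.+1))
  & forall S A B : {set G}, #|S| <= k -> A \subset X -> B \subset X ->
      (forall x y p, x \in A -> y \in B -> gpath x y p -> size p <= d ->
         {subset x :: p <= Y} -> exists2 z, z \in x :: p & z \in S) ->
      separates d S A B].
Proof.
have F_size x y f : f \in path_sets x y -> #|f| <= d.+1.
  move=> /path_setsP[p [_ pd] ->]; rewrite cardsE.
  by apply: leq_trans (card_size _) _.
have ker (xy : G * G) := hitting_kernel k (@F_size xy.1 xy.2).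
have {ker}[K KP] := choice ker.
exists (X :|: \bigcup_(x in X) \bigcup_(y in X) cover (K (x, y))); split.
- exact: subsetUl.
- apply: leq_trans (leq_card_setU _ _) _; rewrite leq_add2l.
  apply: leq_trans (leq_card_bigcup _ _) _; rewrite -sum_nat_const.
  apply: leq_sum => x _.
  apply: leq_trans (leq_card_bigcup _ _) _; rewrite -sum_nat_const.
  apply: leq_sum => y _; have [KF Kc _] := KP (x, y).
  apply: leq_trans (leq_card_bigcup _ _) _.
  apply: (@leq_trans (\sum_(f in K (x, y)) d.+1)).
    by apply: leq_sum => f /(subsetP KF)/F_size.
  by rewrite sum_nat_const leq_mul2r Kc orbT.
move=> S A B Sk AX BX hit x y p xA yB xp pd.
have [KF _ Khit] := KP (x, y).
have : [set z in x :: p] :&: S != set0.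
  apply: Khit => //; last by apply/path_setsP; exists p.
  move=> f fK; have /path_setsP[p' [xp' p'd] fp'] := subsetP KF f fK.
  have [|z zp zS] := hit x y p' xA yB xp' p'd.
    move=> z zp; rewrite inE; apply/orP; right.
    apply/bigcupP; exists x; first exact: (subsetP AX).
    apply/bigcupP; exists y; first exact: (subsetP BX).
    by apply/bigcupP; exists f => //; rewrite fp' inE.
  by apply/set0Pn; exists z; rewrite inE fp' inE zp.
by move=> /set0Pn[z]; rewrite !inE => /andP[zp zS]; exists z; rewrite ?inE.
Qed.

End PathKernel.

(** Replacing [B] by [B0] allows [B0] to be deleted from [A] at small cost, which makes the final
    sets disjoint. *)
Lemma few_common (V : finType) (A B : {set V}) M :
  2 * M <= #|A :|: B| -> exists B0 : {set V}, [/\ B0 \subset B,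
    #|A :&: B0| * M <= 2 * #|A| & #|B| <= M.+2 * #|B0|].
Proof.
(* If [#|A| < M], a single common vertex may already be too much damage, but then [B :\: A] is more
   than half of [B]. *)
move=> Mn; have [AM|MA] := ltnP #|A| M.
  exists (B :\: A); split; first exact: subsetDl.
    rewrite (_ : A :&: _ = set0) ?cards0 //.
    by apply/setP => v; rewrite !inE; case: (v \in A); rewrite ?andbF.
  have : #|A :|: B| = #|A| + #|B :\: A|.
    have := cardsUI A (B :\: A); rewrite (_ : A :&: _ = set0) ?cards0 ?addn0.
      by move<-; apply: eq_card => v; rewrite !inE; case: (v \in A).
    by apply/setP => v; rewrite !inE; case: (v \in A); rewrite ?andbF.
  have := cardsID A B; have := subset_leq_card (subsetIr B A); nia.
have sumA (J : {set V}) : \sum_(b in J) (b \in A) = #|A :&: J|.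
  rewrite -sum1_card big_mkcond [RHS]big_mkcond /=; apply: eq_bigr => b _.
  by rewrite inE; case: (b \in J); case: (b \in A).
have [||J [JB JA JM]] := @heavy_bin V B (fun=> 1) (fun b => b \in A) #|A| M M.
- by move=> b _; case: (b \in A); rewrite ?mul1n.
- by rewrite mulnC leq_mul2l sumA (subset_leq_card (subsetIl _ _)) orbT.
exists J; split=> //; first by rewrite -sumA.
by rewrite !sum1_card in JM; apply: leq_trans JM _; apply: leq_mul.
Qed.

(** * Choice of the integer parameters and assembly *)

Lemma root_exists Q L n : 0 < Q -> L ^ Q <= n ->
  exists z, [/\ L <= z, z ^ Q <= n & n < z.+1 ^ Q].
Proof.
move=> Q0 Ln.
have bd z : z ^ Q <= n -> z <= n.
  exact/leq_trans/leq_expn_self.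
have [z zn zmax] := ex_maxnP (ex_intro (fun z => z ^ Q <= n) L Ln) bd.
exists z; split=> //; first exact: zmax.
by rewrite ltnNge; apply/negP => /zmax; rewrite ltnn.
Qed.

Lemma kernel_bound n d : 0 < n ->
  n + n * (n * ((n.+1 * d.+2) ^ d.+1 * d.+1)) <=
  (1 + (2 * d.+2) ^ d.+1 * d.+1) * n ^ (d + 3).
Proof.
move=> n0; rewrite mulnDl mul1n; apply: leq_add; first by rewrite leq_expn_self // addn3.
have le : (n.+1 * d.+2) ^ d.+1 <= (2 * d.+2) ^ d.+1 * n ^ d.+1.
  rewrite -expnMn; apply: leq_expn2r.
  have n2 : n.+1 <= 2 * n by lia.
  by rewrite [leqRHS]mulnAC leq_mul2r n2 orbT.
apply: (@leq_trans (n * (n * ((2 * d.+2) ^ d.+1 * n ^ d.+1 * d.+1)))).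
  by rewrite !leq_mul2l leq_mul2r le !orbT.
by rewrite addn3 !(expnS n d.+2) !(expnS n d.+1) eq_leq //; lia.
Qed.

Lemma sparse_separation T d M q : 0 < M -> 0 < q ->
  exists k0, forall G : sgraph, sparse T [set: G] (@adj G) ->
  forall A B : {set G}, k0 <= #|A :|: B| ->
  exists S A' B' : {set G},
    [/\ A' \subset A, B' \subset B, [disjoint A' & B'] & separates d S A' B'] /\
    [/\ #|A :\: A'| * M <= #|A|, #|B| ^ q <= #|B'| ^ q * #|A :|: B|
      & #|S| ^ q <= #|A :|: B|].
Proof.
move=> M0 q0.
(* All quantities are measured in [u], about [n ^ (1 / Q)]: [#|S|] and the loss in [B] are at most
   [u ^ 6], and [Q = 8 * q] leaves room for [u ^ (6 * q) <= n]. The exponent [s] is chosen so that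
   [#|Y| < u ^ s]. *)
pose Q := 8 * q; pose s := (Q * (d + 3)).+1.
have [C HC] := sparse_wreach T (d + d) s.
pose c1 := 1 + (2 * d.+2) ^ d.+1 * d.+1; pose M1 := 4 * M.
pose L := 8 + C * c1 + c1 + s * M1 + M1 + 4.
exists (L ^ Q + 2 * M1) => G Gs A B; set n := #|A :|: B| => kn.
have Q0 : 0 < Q by rewrite muln_gt0.
have Ln : L ^ Q <= n by apply: leq_trans kn; apply: leq_addr.
have [z [Lz zn nz]] := root_exists Q0 Ln; set u := z.+1 in nz.
have [z8 uCc1 uc1 usM uM] : [/\ 8 <= z, C * c1 < u, c1 < u, s * M1 < u & M1.+2 <= u].
  rewrite /u; move: Lz; rewrite /L; move: (C * c1) (s * M1); clear.
  by move=> x y Lz; split; lia.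
have n0 : 0 < n by apply: leq_trans Ln; rewrite expn_gt0.
have un : u ^ (6 * q) <= n.
  apply: leq_trans zn; rewrite /Q !expnM; apply: leq_expn2r.
  apply: (@leq_trans ((2 * z) ^ 6)).
    by apply: leq_expn2r; rewrite /u; clear -z8; lia.
  rewrite expnMn [z ^ 8](expnD z 2 6) leq_mul2r; apply/orP; right.
  by apply: (@leq_trans (8 ^ 2)) => //; apply: leq_expn2r.
(* Kernels for separators of size up to [n] suffice, as [#|S| <= #|S| ^ q <= n] will hold. *)
have [Y [ABY Yc Ysep]] := path_kernel d n (A :|: B).
have Yu : #|Y| <= c1 * u ^ (Q * (d + 3)).
  apply: leq_trans Yc (leq_trans (kernel_bound d n0) _).
  by rewrite expnM leq_mul2l leq_expn2r ?orbT // ltnW.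
have Y0 : Y != set0.
  by rewrite -card_gt0; apply: leq_trans (subset_leq_card ABY).
have Ysp : sparse T Y (@adj G) by apply: sparse_sub Gs; [exact: adj_sym | exact: subsetT].
have [rho [w [wC wY]]] := HC G Y (@adj G) (@adj_sym G) Ysp Y0.
have Yus : #|Y| < u ^ s.
  by apply: leq_ltn_trans Yu _; rewrite /s expnS ltn_pmul2r ?expn_gt0.
have wu : w <= u.
  rewrite leqNgt; apply/negP => uw.
  have : u ^ s <= C * (c1 * u ^ (Q * (d + 3))).
    apply: leq_trans (leq_trans wC _); first by apply/leq_expn2r/ltnW.
    by rewrite leq_mul2l Yu orbT.
  by rewrite /s expnS mulnA leq_pmul2r ?expn_gt0 // leqNgt uCc1.
have [B0 [B0B AB0 BB0]] := @few_common _ A B M1 (leq_trans (leq_addl _ _) kn).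
have ABY' v : v \in A :|: B0 -> v \in Y.
  move=> vAB; apply: (subsetP ABY); move: vAB; rewrite !inE => /orP[->//|].
  by move=> /(subsetP B0B)->; rewrite orbT.
pose W r := wreach (@adj G) Y rho r.
have W1u v : v \in A :|: B0 -> #|W d v| <= u.
  move=> /ABY' vY; apply: leq_trans wu; apply: leq_trans (wY v vY).
  by apply/subset_leq_card/wreach_sub; apply: leq_addl.
have W2u y : y \in Y -> #|W (d + d) y| <= u.
  by move=> yY; apply: leq_trans wu; apply: wY.
have W1Y v : v \in A :|: B0 -> W d v \subset Y.
  by move=> _; apply/subsetP => m; rewrite inE => /andP[].
have W12 b m m' : b \in B0 -> m \in W d b -> m' \in W d b ->
    rho m <= rho m' -> m \in W (d + d) m'.
  move=> bB; apply: wreach_wreach; first exact: adj_sym.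
  by apply: ABY'; rewrite inE bB orbT.
have [S [A1 [B' [[A1A B'B A1M B'c Sc] hub]]]] :=
  @select_classes _ Y A B0 (W d) (W (d + d)) rho u s u M1 (ltn0Sn z) W1Y W1u W2u W12 Yus.
have Su : #|S| <= u ^ 6.
  apply: leq_trans Sc _.
  have -> : s * (u * (u * u) * u * M1 * u) = s * M1 * u ^ 5 by clear; lia.
  by rewrite (expnS u 5) leq_mul2r (ltnW usM) orbT.
have Sq : #|S| ^ q <= n by apply: leq_trans un; rewrite expnM; apply: leq_expn2r.
have B'u : #|B| <= #|B'| * u ^ 6.
  apply: leq_trans BB0 _.
  apply: (@leq_trans (M1.+2 * ((s * (u * (u * u) * u * M1)).+1 * #|B'|))).
    by rewrite leq_mul2l B'c orbT.
  rewrite mulnA mulnC leq_mul2l (expnS u 5); apply/orP; right.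
  apply: leq_mul => //; apply: (@leq_trans ((s * M1).+1 * u ^ 4)).
    have := expn_gt0 u 4; rewrite /u /=; move: z.+1 => v; clear; lia.
  by rewrite (expnS u 4) leq_mul2r usM orbT.
(* Passing to [A1] and deleting [B0] each cost at most [2 * #|A| / M1] vertices of [A], hence
   [M1 = 4 * M]. *)
exists S, (A1 :\: B0), B'; split; split=> //.
- exact: subset_trans (subsetDl _ _) A1A.
- exact: subset_trans B0B.
- rewrite disjoint_subset; apply/subsetP => v; rewrite !inE => /andP[vB0 _].
  by apply: contra vB0; apply: (subsetP B'B).
- apply: Ysep.
  + by apply: leq_trans Sq; apply: leq_expn_self.
  + by apply: subset_trans (subsetUl A B); apply: subset_trans (subsetDl _ _) A1A.
  + by apply: subset_trans (subsetUr A B); apply: subset_trans B0B.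
  move=> x y p; rewrite inE => /andP[_ xA] yB /and3P[xp _ /eqP py] pd pY.
  have [m [mp mx my]] := path_wreach rho (@adj_sym G) xp pY pd.
  by exists m => //; apply: (hub x y) => //; rewrite -py.
- rewrite -(leq_pmul2l (isT : 0 < 4)) mulnCA -/M1.
  have le : #|A :\: (A1 :\: B0)| <= #|A :\: A1| + #|A :&: B0|.
    apply: leq_trans (leq_card_setU _ _); apply/subset_leq_card/subsetP => v.
    by rewrite !inE; case: (v \in A); case: (v \in A1); case: (v \in B0).
  apply: (@leq_trans ((#|A :\: A1| + #|A :&: B0|) * M1)).
    by rewrite leq_mul2r le orbT.
  by rewrite mulnDl -[4]/(2 + 2) mulnDl leq_add.
apply: (@leq_trans ((#|B'| * u ^ 6) ^ q)); first exact: leq_expn2r.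
by rewrite expnMn -expnM leq_mul2l un orbT.
Qed.

(** * Passage to real exponents *)

Import Order.TTheory GRing.Theory Num.Theory.

Local Open Scope ring_scope.

(** Since [n >= 1] and [q * eps >= 1], [n] is at most the [q]-th power of its [eps]-th power; take
    [q]-th roots. *)
Lemma ler_mul_powR (R : realType) (a b n q : nat) (eps : R) :
  (0 < n)%N -> 1 <= q%:R * eps -> (a ^ q <= b ^ q * n)%N ->
  a%:R <= b%:R * n%:R `^ eps.
Proof.
move=> n0 qe abn.
have q0 : (0 < q)%N.
  by case: q qe {abn} => // ; rewrite mul0r ler10.
have n1 : 1 <= n%:R :> R by rewrite ler1n.
rewrite -(@ler_pXn2r _ q) ?nnegrE ?mulr_ge0 ?powR_ge0 //.
have nq : n%:R <= (n%:R `^ eps) ^+ q :> R.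
  rewrite -powR_mulrn ?powR_ge0 // -powRrM -[leLHS]powRr1 //.
  by rewrite ler_powR // mulrC.
rewrite exprMn; apply: (@le_trans _ _ (b%:R ^+ q * n%:R)).
  by rewrite -!natrX -natrM ler_nat.
by rewrite ler_wpM2l // exprn_ge0.
Qed.

Theorem lemma3 (R : realType) (C : sgraph -> Prop) (hC : nowhere_dense C)
    (d : nat) (hd : (0 < d)%N) (eps : R) (heps : 0 < eps) :
  exists k0 : nat, forall G : sgraph, C G -> forall A B : {set G},
    (k0 <= #|A :|: B|)%N ->
    exists S A' B' : {set G},
      A' \subset A /\ B' \subset B /\ [disjoint A' & B'] /\
      (1 - eps) * #|A|%:R <= #|A'|%:R /\
      #|B|%:R / #|A :|: B|%:R `^ eps <= #|B'|%:R /\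
      #|S|%:R <= #|A :|: B|%:R `^ eps /\
      separates d S A' B'.
Proof.
have [T CT] := nowhere_dense_sparse hC.
(* [q >= 1 / eps] serves twice: a proportion [1 / q] of [A] may be lost, and
   [n ^ (1 / q) <= n ^ eps]. *)
pose q := (Num.bound eps^-1).
have qe : 1 <= q%:R * eps.
  rewrite -ler_pdivrMr // div1r ltW //; apply: le_lt_trans (archi_boundP _).
    exact: lexx.
  by rewrite invr_ge0 ltW.
have q0 : (0 < q)%N.
  by case: q qe => //; rewrite mul0r ler10.
have [k0 Hk0] := sparse_separation T d q0 q0.
(* The successor makes [A :|: B] nonempty, so that its real power is positive. *)
exists k0.+1 => G CG A B kn.
have n0 : (0 < #|A :|: B|)%N by apply: leq_trans kn.
have [S [A' [B' [[A'A B'B dAB sep] [A'c B'c Sc]]]]] := Hk0 G (CT G CG) A B (ltnW kn).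
exists S, A', B'; do 3![split=> //]; split; last split; last split=> //.
- have cA : (#|A| = #|A'| + #|A :\: A'|)%N.
    by rewrite -(cardsID A' A) (setIidPr A'A).
  rewrite mulrBl mul1r lerBlDr [X in X%:R <= _]cA natrD lerD2l.
  rewrite -(@ler_pM2l _ q%:R) ?ltr0n // mulrA.
  apply: (@le_trans _ _ (#|A|%:R)); first by rewrite -natrM ler_nat mulnC.
  by rewrite ler_peMl.
- rewrite ler_pdivrMr ?powR_gt0 ?ltr0n //.
  exact: ler_mul_powR B'c.
rewrite -[leRHS]mul1r; apply: (@ler_mul_powR _ _ 1 _ q) => //.
by rewrite exp1n mul1n.
Qed.
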